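(* Let $\lambda>1$, $\lambda_j=\lambda^j$, $\nu,\mu>0$, $d_i\ge 0$, and $\theta=\frac{5-\delta}{2}$. For any initial data $(a^0,b^0)\in H\times H$, with $H=\ell^2$, there exists a Leray-Hopf solution $(a(t),b(t))$ on $[0,\infty)$ of the system, for $j\ge1$ and with $a_0=b_0=0$, $$\frac{d}{dt}a_j=-\nu\lambda_j^2a_j-\lambda_j^\theta a_ja_{j+1}+\lambda_{j-1}^\theta a_{j-1}^2+\lambda_j^\theta b_jb_{j+1}-\lambda_{j-1}^\theta b_{j-1}^2,$$ $$\frac{d}{dt}b_j=-\mu\lambda_j^2b_j-\lambda_j^\theta a_jb_{j+1}+\lambda_j^\theta b_ja_{j+1}-d_i\left(\lambda_j^{\theta+1}b_jb_{j+1}-\lambda_{j-1}^{\theta+1}b_{j-1}^2\right),$$ satisfying $(a(0),b(0))=(a^0,b^0)$.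
   Context: Here $\delta$ is a real parameter (the intermittency dimension; physically $\delta\in[0,3]$). Sequences are real and indexed by $j\ge1$, $a(t)=(a_j(t))_{j\ge1}$, $b(t)=(b_j(t))_{j\ge1}$; the convention $a_0=b_0=0$ is used in the equations for $j=1$. $H=\ell^2$ has norm $|u|=(\sum_{n\ge1}u_n^2)^{1/2}$, and $\|u\|_1=(\sum_{n\ge1}\lambda_n^{2}u_n^2)^{1/2}$. Weak solution on $[t_0,\infty)$: a pair of $H$-valued functions $(a(t),b(t))$ on $[t_0,\infty)$ such that $a_j,b_j\in C^1([t_0,\infty))$ and satisfy the system for all $j$. Leray-Hopf solution on $[t_0,\infty)$: a weak solution satisfying the energy inequality $$|a(t)|^2+|b(t)|^2+2\nu\int_{t_1}^t\|a(\tau)\|_1^2\,d\tau+2\mu\int_{t_1}^t\|b(\tau)\|_1^2\,d\tau\le|a(t_1)|^2+|b(t_1)|^2$$ for almost every $t_1\in[t_0,\infty)$ and all $t\ge t_1$. *)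

(* Defs.v *)
From HB Require Import structures.
From mathcomp Require Import all_boot all_order all_algebra.
From mathcomp Require Import all_classical all_reals all_analysis.
Set Implicit Arguments.
Unset Strict Implicit.
Unset Printing Implicit Defensive.
Import Order.TTheory GRing.Theory Num.Theory.
Import numFieldNormedType.Exports.
Local Open Scope classical_set_scope.
Local Open Scope ring_scope.

(* A real sequence (u_j)_{j >= 1} is represented by u : nat -> R; the entry
   u 0 is the conventional u_0 of the equation for j = 1, and membership in
   [ell2] forces u 0 = 0. *)

Definition wavenumber (R : realType) (lam : R) (j : nat) : R := lam ^+ j.

(* Norms are extended-real valued, +oo exactly when the series diverges. *)
Definition normH (R : realType) (u : nat -> R) : \bar R :=
  sqrte (\sum_(1 <= n <oo) (u n ^+ 2)%:E)%E.

Definition norm1 (R : realType) (lam : R) (u : nat -> R) : \bar R :=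
  sqrte (\sum_(1 <= n <oo) (wavenumber lam n ^+ 2 * u n ^+ 2)%:E)%E.

Definition ell2 (R : realType) : set (nat -> R) :=
  [set u | u 0%N = 0 /\ (normH u < +oo)%E].

Definition rhs_a (R : realType) (lam nu theta : R) (a b : nat -> R)
    (j : nat) : R :=
  - nu * wavenumber lam j ^+ 2 * a j
  - wavenumber lam j `^ theta * a j * a j.+1
  + wavenumber lam j.-1 `^ theta * a j.-1 ^+ 2
  + wavenumber lam j `^ theta * b j * b j.+1
  - wavenumber lam j.-1 `^ theta * b j.-1 ^+ 2.

Definition rhs_b (R : realType) (lam mu di theta : R) (a b : nat -> R)
    (j : nat) : R :=
  - mu * wavenumber lam j ^+ 2 * b j
  - wavenumber lam j `^ theta * a j * b j.+1
  + wavenumber lam j `^ theta * b j * a j.+1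
  - di * (wavenumber lam j `^ (theta + 1) * b j * b j.+1
          - wavenumber lam j.-1 `^ (theta + 1) * b j.-1 ^+ 2).

(* f has derivative l at t relative to A; for A = [t0, +oo[ this is the usual
   derivative at t > t0 and the right derivative at t = t0. *)
Definition is_derive_within (R : realType) (A : set R) (f : R -> R)
    (t l : R) : Prop :=
  (f s - f t) / (s - t) @[s --> within A t^'] --> l.

Definition C1_within (R : realType) (A : set R) (f : R -> R) : Prop :=
  exists2 df : R -> R, {within A, continuous df} &
    forall t, A t -> is_derive_within A f t (df t).

(* Only the values of a and b at times t >= t0 matter. *)
Definition weak_solution (R : realType) (lam nu mu di theta t0 : R)
    (a b : R -> nat -> R) : Prop :=
  [/\ forall t, t0 <= t -> ell2 (a t) /\ ell2 (b t),
      forall j, (1 <= j)%N -> C1_within `[t0, +oo[ (fun t => a t j) /\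
                              C1_within `[t0, +oo[ (fun t => b t j) &
      forall j t, (1 <= j)%N -> t0 <= t ->
        is_derive_within `[t0, +oo[ (fun s => a s j) t
          (rhs_a lam nu theta (a t) (b t) j) /\
        is_derive_within `[t0, +oo[ (fun s => b s j) t
          (rhs_b lam mu di theta (a t) (b t) j)].

Definition energy_inequality (R : realType) (lam nu mu : R)
    (a b : R -> nat -> R) (t1 t : R) : Prop :=
  (normH (a t) ^+ 2 + normH (b t) ^+ 2
     + (2 * nu)%:E *
         \int[lebesgue_measure]_(tau in `[t1, t]) (norm1 lam (a tau) ^+ 2)
     + (2 * mu)%:E *
         \int[lebesgue_measure]_(tau in `[t1, t]) (norm1 lam (b tau) ^+ 2)
   <= normH (a t1) ^+ 2 + normH (b t1) ^+ 2)%E.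

Definition leray_hopf_solution (R : realType) (lam nu mu di theta t0 : R)
    (a b : R -> nat -> R) : Prop :=
  weak_solution lam nu mu di theta t0 a b /\
  {ae (@lebesgue_measure R), forall t1, t0 <= t1 ->
     forall t, t1 <= t -> energy_inequality lam nu mu a b t1 t}.

(* Main.v *)
(* Galerkin truncations are solved by the explicit Euler scheme with a step so
   small that the quadratic remainder is absorbed by the dissipation: since the
   nonlinearity conserves the energy, the discrete energy decays exactly, up to
   a factor 1 - 1/(N+2) in front of the dissipation.  All coordinates, and the
   energies themselves, are then passed to the limit along one ultrafilter on
   nat, pointwise in time.  Each coordinate satisfies
     |p_j(s) - p_j(t) - (s - t) F_j(p(t))| <= C_j (s - t)^2,
   which gives the equation with no integral formulation.  The limit E of the
   energies is nonincreasing, dominates |p|^2 and satisfies the energy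
   inequality for all times.  Finally the tail estimate
     sum_{j > M} |u_j|^2 <= eps * dissipation(u),
   integrated in time, gives int E <= int |p|^2, so that E = |p|^2 almost
   everywhere; these are the admissible initial times t1. *)
Require Import Defs.
From HB Require Import structures.
From mathcomp Require Import all_boot all_order all_algebra.
From mathcomp Require Import all_classical all_reals all_analysis.
From mathcomp Require Import measurable_realfun ring lra.
Import Order.TTheory GRing.Theory Num.Theory.
Import numFieldNormedType.Exports.
Local Open Scope classical_set_scope.
Local Open Scope ring_scope.
Set Implicit Arguments.
Unset Strict Implicit.

(** * Locally Lipschitz functions of finitely many coordinates *)

Section LocallyLipschitz.
Variable R : realType.
Implicit Types (u v : bool -> nat -> R) (f g : (bool -> nat -> R) -> R).

(* A state [u] collects both fields: [u true] is the sequence a and [u false]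
   the sequence b. *)
Definition state_bounded (r : R) u := forall c i, `|u c i| <= r.

(** Closeness is asked of the coordinates up to m only, so on bounded states f depends on these
    alone; convergence of each coordinate then suffices to pass f to the limit. The number d is any
    common bound, in place of a maximum. *)
Definition lipschitz_window (r : R) (m : nat) f :=
  exists2 K : R, 0 <= K & forall u v (d : R), state_bounded r u -> state_bounded r v ->
    (forall c i, (i <= m)%N -> `|u c i - v c i| <= d) -> `|f u - f v| <= K * d.

Lemma window_radius_ge0 m (d : R) u v :
  (forall c i, (i <= m)%N -> `|u c i - v c i| <= d) -> 0 <= d.
Proof. by move/(_ true 0%N isT); apply: le_trans. Qed.

Lemma lipschitz_window_coord r m c i :
  (i <= m)%N -> lipschitz_window r m (fun u => u c i).
Proof. by move=> im; exists 1 => // u v d _ _ uv; rewrite mul1r uv. Qed.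

Lemma lipschitz_window_cst r m k : lipschitz_window r m (fun=> k).
Proof. by exists 0 => // u v d _ _ _; rewrite subrr normr0 mul0r. Qed.

Lemma lipschitz_windowD r m f g : lipschitz_window r m f ->
  lipschitz_window r m g -> lipschitz_window r m (fun u => f u + g u).
Proof.
move=> [K K0 Kf] [L L0 Lg]; exists (K + L); first exact: addr_ge0.
move=> u v d bu bv uv; rewrite opprD addrACA mulrDl.
by rewrite (le_trans (ler_normD _ _))// lerD ?Kf ?Lg.
Qed.

Lemma lipschitz_window_sum (I : Type) (s : seq I) r m (f : I -> _ -> R) :
  (forall i, lipschitz_window r m (f i)) ->
  lipschitz_window r m (fun u => \sum_(i <- s) f i u).
Proof.
move=> H; elim: s => [|i s IH].
  by under [X in lipschitz_window _ _ X]eq_fun do rewrite big_nil;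
    exact: lipschitz_window_cst.
under [X in lipschitz_window _ _ X]eq_fun do rewrite big_cons.
exact: lipschitz_windowD.
Qed.

Lemma lipschitz_windowM r m f g : lipschitz_window r m f ->
  lipschitz_window r m g -> lipschitz_window r m (fun u => f u * g u).
Proof.
move=> [K K0 Kf] [L L0 Lg].
(* A Lipschitz function is bounded on the ball, by comparison with the zero state; the product rule
   needs this. *)
have bnd (h : _ -> R) (k : R) u : (forall u v (d : R), state_bounded r u -> state_bounded r v ->
    (forall c i, (i <= m)%N -> `|u c i - v c i| <= d) -> `|h u - h v| <= k * d) ->
    state_bounded r u -> `|h u| <= k * r + `|h (fun _ _ => 0)|.
  move=> kh bu; rewrite -[X in `|X|](subrK (h (fun _ _ => 0))).
  rewrite (le_trans (ler_normD _ _))// lerD2r; apply: kh => //.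
    by move=> c i; rewrite normr0 (le_trans _ (bu c i)).
  by move=> c i _; rewrite subr0.
(* The outer absolute values make A and B nonnegative for r of either sign. *)
pose A : R := `|K * r + `|f (fun _ _ => 0)| |; pose B : R := `|L * r + `|g (fun _ _ => 0)| |.
exists (A * L + B * K); first by rewrite addr_ge0// mulr_ge0// normr_ge0.
move=> u v d bu bv uv; have d0 := window_radius_ge0 uv.
have -> : f u * g u - f v * g v = f u * (g u - g v) + g v * (f u - f v) by ring.
rewrite (le_trans (ler_normD _ _))// !normrM mulrDl -!mulrA lerD//.
  by apply: ler_pM => //; [rewrite (le_trans (bnd f K u Kf bu))// ler_norm|exact: Lg].
by apply: ler_pM => //; [rewrite (le_trans (bnd g L v Lg bv))// ler_norm|exact: Kf].
Qed.

Lemma lipschitz_windowN r m f :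
  lipschitz_window r m f -> lipschitz_window r m (fun u => - f u).
Proof.
move=> [K K0 Kf]; exists K => // u v d bu bv uv.
by rewrite -normrN opprD !opprK; exact: Kf.
Qed.

Definition weighted_sqsum (w : bool -> nat -> R) (M : nat) u :=
  \sum_(1 <= j < M.+1) \sum_(c : bool) w c j * u c j ^+ 2.

Lemma lipschitz_window_sqsum r w M : lipschitz_window r M (weighted_sqsum w M).
Proof.
rewrite /weighted_sqsum.
(* [lipschitz_window_sum] wants every summand to be Lipschitz, whatever its index; the guard
   replaces those outside the window by 0. *)
have -> : (fun u => \sum_(1 <= j < M.+1) \sum_(c : bool) w c j * u c j ^+ 2) =
  (fun u => \sum_(j <- index_iota 1 M.+1) (if (j <= M)%N then
     \sum_(c : bool) w c j * u c j ^+ 2 else 0)).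
  apply/funext => u; rewrite !big_seq; apply: eq_bigr => j.
  by rewrite mem_index_iota ltnS => /andP[_ ->].
apply: lipschitz_window_sum => j; have [jM|_] := boolP (j <= M)%N; last exact: lipschitz_window_cst.
apply: lipschitz_window_sum => c; apply: lipschitz_windowM.
  exact: lipschitz_window_cst.
by apply: lipschitz_windowM; exact: lipschitz_window_coord.
Qed.

End LocallyLipschitz.

(** * Lipschitz bounds and energy balance of the Hall shell model *)

Section HallShell.
Variables (R : realType) (lam nu mu di theta : R).

Definition hall_rhs (c : bool) (j : nat) (u : bool -> nat -> R) : R :=
  if c then rhs_a lam nu theta (u true) (u false) j
  else rhs_b lam mu di theta (u true) (u false) j.

(* The factor 2 comes from differentiating |u|^2. *)
Definition hall_weight (c : bool) (j : nat) : R :=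
  2 * (if c then nu else mu) * wavenumber lam j ^+ 2.

Lemma hall_rhs_lipschitz r c j : lipschitz_window r j.+1 (hall_rhs c j).
Proof.
have j0 : (j <= j.+1)%N by [].
have j1 : (j.-1 <= j.+1)%N by rewrite (leq_trans (leq_pred _)).
by case: c; rewrite /hall_rhs /rhs_a /rhs_b;
  repeat (apply: lipschitz_window_coord => // || apply: lipschitz_window_cst ||
    apply: lipschitz_windowD || apply: lipschitz_windowN ||
    apply: lipschitz_windowM).
Qed.

Lemma hall_rhs0 c j : hall_rhs c j (fun _ _ => 0) = 0.
Proof. by case: c; rewrite /hall_rhs /rhs_a /rhs_b; ring. Qed.

Lemma hall_energy_balance N u : u true 0%N = 0 -> u false 0%N = 0 ->
  u true N.+1 = 0 -> u false N.+1 = 0 ->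
  2 * (\sum_(1 <= j < N.+1) \sum_(c : bool) u c j * hall_rhs c j u) =
  - weighted_sqsum hall_weight N u.
Proof.
move=> a0 b0 aN bN.
(* The sum telescopes: [fl n] is the energy flux from shell n.+1 to shell n. *)
pose fl n := wavenumber lam n `^ theta * (u false n ^+ 2 - u true n ^+ 2) * u true n.+1
  - di * wavenumber lam n `^ (theta + 1) * u false n ^+ 2 * u false n.+1.
suff H m : 2 * (\sum_(1 <= j < m.+1) \sum_(c : bool) u c j * hall_rhs c j u) =
  - weighted_sqsum hall_weight m u + 2 * (fl m - fl 0%N).
  (* Both end fluxes vanish: each term of [fl 0] has a factor from shell 0, each term of [fl N] one
     from shell N+1. *)
  by rewrite H /fl aN bN a0 b0; ring.
elim: m => [|m IH].
  by rewrite /weighted_sqsum !big_geq// subrr; ring.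
rewrite /weighted_sqsum in IH *.
rewrite big_nat_recr//= mulrDr IH [in RHS]big_nat_recr//= !big_bool /=.
by rewrite /hall_weight /hall_rhs /rhs_a /rhs_b /fl /=; ring.
Qed.

End HallShell.

(** * The Euler scheme for the truncated system *)

Section GalerkinEuler.
Variables (R : realType) (F : bool -> nat -> (bool -> nat -> R) -> R).
Variables (w : bool -> nat -> R) (u0 : bool -> nat -> R) (E0 kappa : R).
Variable K : nat -> R.

Local Notation state := (bool -> nat -> R).
Local Notation sq := (weighted_sqsum (fun _ _ => 1)).
Local Notation dissip := (weighted_sqsum w).

Hypothesis E0_ge0 : 0 <= E0.
Hypothesis kappa_gt0 : 0 < kappa.
Hypothesis w_ge : forall c j, kappa <= w c j.
Hypothesis u0_0 : forall c, u0 c 0%N = 0.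
Hypothesis u0_E0 : forall N, sq N u0 <= E0.
Hypothesis F_0 : forall c j, F c j (fun _ _ => 0) = 0.
Hypothesis F_balance : forall N (u : state), (forall c, u c 0%N = 0) ->
  (forall c, u c N.+1 = 0) ->
  2 * (\sum_(1 <= j < N.+1) \sum_(c : bool) u c j * F c j u) = - dissip N u.
Hypothesis K_ge0 : forall j, 0 <= K j.
(* The radius 1 + E0 bounds sqrt E0, hence every coordinate of a state of
   energy at most E0. *)
Hypothesis F_lip : forall c j (u v : state) (d : R),
  state_bounded (1 + E0) u -> state_bounded (1 + E0) v ->
  (forall c i, (i <= j.+1)%N -> `|u c i - v c i| <= d) ->
  `|F c j u - F c j v| <= K j * d.

Lemma weighted_sqsum_ge0 (v : bool -> nat -> R) N (u : state) :
  (forall c j, 0 <= v c j) -> 0 <= weighted_sqsum v N u.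
Proof.
move=> v0; apply: sumr_ge0 => j _; apply: sumr_ge0 => c _.
by rewrite mulr_ge0// sqr_ge0.
Qed.

Lemma weighted_sqsum_widen (v : bool -> nat -> R) M N (u : state) :
  (forall c j, 0 <= v c j) -> (M <= N)%N ->
  weighted_sqsum v M u <= weighted_sqsum v N u.
Proof.
move=> v0 MN; rewrite /weighted_sqsum [leRHS](@big_cat_nat _ _ _ M.+1)//=.
rewrite lerDl; apply: sumr_ge0 => j _; apply: sumr_ge0 => c _.
by rewrite mulr_ge0// sqr_ge0.
Qed.

Lemma w_ge0 c j : 0 <= w c j.
Proof. exact: le_trans (ltW kappa_gt0) (w_ge c j). Qed.

(** The Poincaré inequality of the model; through it the dissipation pays for the quadratic
    remainder of an Euler step. *)
Lemma dissip_ge N u : kappa * sq N u <= dissip N u.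
Proof.
rewrite /weighted_sqsum mulr_sumr; apply: ler_sum => j _.
rewrite mulr_sumr; apply: ler_sum => c _.
by rewrite /= mul1r ler_wpM2r// sqr_ge0.
Qed.

(** Above M each squared coordinate is at most eps times its own dissipation; the dissipation of the
    shells up to M is added for free, being nonnegative. *)
Lemma sq_tail M N eps u : 0 <= eps -> (forall c j, (M < j)%N -> 1 <= eps * w c j) ->
  (M <= N)%N -> sq N u <= sq M u + eps * dissip N u.
Proof.
move=> e0 Hw MN; rewrite /weighted_sqsum (@big_cat_nat _ _ _ M.+1)//=.
rewrite [X in eps * X](@big_cat_nat _ _ _ M.+1)//= lerD2l mulrDr.
apply: ler_wpDl.
  by rewrite mulr_ge0//; exact: (weighted_sqsum_ge0 (v := w) _ _ w_ge0).
rewrite mulr_sumr 2!big_nat; apply: ler_sum => j /andP[Mj _].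
rewrite mulr_sumr; apply: ler_sum => c _.
by rewrite /= [leRHS]mulrA ler_wpM2r ?sqr_ge0// Hw.
Qed.

Definition supported N (u : state) :=
  (forall c, u c 0%N = 0) /\ (forall c j, (N < j)%N -> u c j = 0).

Lemma coord_le_sqrt N u : supported N u ->
  forall c j, `|u c j| <= Num.sqrt (sq N u).
Proof.
move=> [z0 zN] c j; case: (posnP j) => [->|j0].
  by rewrite z0 normr0 sqrtr_ge0.
case: (leqP j N) => [jN|Nj]; last by rewrite zN// normr0 sqrtr_ge0.
rewrite -sqrtr_sqr ler_wsqrtr// /weighted_sqsum.
rewrite (bigD1_seq j) ?iota_uniq ?mem_index_iota ?j0//= (bigD1 c)//= mul1r -addrA.
rewrite lerDl addr_ge0//; first by apply: sumr_ge0 => ? _; rewrite mul1r sqr_ge0.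
by apply: sumr_ge0 => ? _; apply: sumr_ge0 => ? _; rewrite mul1r sqr_ge0.
Qed.

Lemma sqrt_le_1D (x : R) : 0 <= x -> Num.sqrt x <= 1 + x.
Proof.
move=> x0; have := sqr_sqrtr x0; have := sqrtr_ge0 x.
move: (Num.sqrt x) => y y0 <-.
by have := sqr_ge0 (y - 1); have := sqr_ge0 y; nra.
Qed.

Lemma supported_bounded N u : supported N u -> sq N u <= E0 ->
  state_bounded (1 + E0) u.
Proof.
move=> su uE c j; rewrite (le_trans (coord_le_sqrt su _ _))//.
by rewrite (le_trans (ler_wsqrtr uE))// sqrt_le_1D.
Qed.

(** Only the output is truncated: on states supported in 1..N the argument u already has a zero at
    N+1, which is what [F_balance] requires. *)
Definition galerkin_rhs N c j (u : state) : R :=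
  if (0 < j <= N)%N then F c j u else 0.

Fixpoint euler N (h : R) (k : nat) : state :=
  if k is k'.+1 then
    fun c j => euler N h k' c j + h * galerkin_rhs N c j (euler N h k')
  else fun c j => if (j <= N)%N then u0 c j else 0.

Lemma galerkin_rhs_lip N c j (u v : state) (d : R) :
  state_bounded (1 + E0) u -> state_bounded (1 + E0) v ->
  (forall c i, (i <= j.+1)%N -> `|u c i - v c i| <= d) ->
  `|galerkin_rhs N c j u - galerkin_rhs N c j v| <= K j * d.
Proof.
move=> bu bv uv; rewrite /galerkin_rhs; case: ifP => _; first exact: F_lip.
by rewrite subrr normr0 mulr_ge0// (window_radius_ge0 uv).
Qed.

Lemma galerkin_rhs0 N c j : galerkin_rhs N c j (fun _ _ => 0) = 0.
Proof. by rewrite /galerkin_rhs F_0; case: ifP. Qed.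

(** Comparison with the zero state, where F vanishes. The bound is linear in the size of u, so that
    the sum of the squares of F is controlled by the energy and not just by a constant. *)
Lemma galerkin_rhs_bound N c j (u : state) (d : R) :
  state_bounded (1 + E0) u -> (forall c i, `|u c i| <= d) ->
  `|galerkin_rhs N c j u| <= K j * d.
Proof.
move=> bu ud; rewrite -[X in `|X|]subr0 -(galerkin_rhs0 N c j).
apply: galerkin_rhs_lip => //.
  by move=> ? ?; rewrite normr0 addr_ge0.
by move=> ? ? _; rewrite subr0.
Qed.

(** * Energy decay and consistency for one truncation and one step size *)

Section FixedStep.
Variables (N : nat) (h : R).
Hypothesis h_gt0 : 0 < h.
Hypothesis h_small :
  h * (\sum_(1 <= j < N.+1) \sum_(c : bool) K j ^+ 2) * N.+2%:R <= kappa.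
Local Notation U := (euler N h).
(** Not the exponent of the model: the share of the dissipation that survives discretisation. With
    N+2 it is at least 1/2 for every N. *)
Local Notation theta := (1 - N.+2%:R^-1 : R).

Lemma theta_ge_half : 2^-1 <= theta.
Proof.
have : (N.+2%:R : R)^-1 <= 2^-1 by rewrite lef_pV2 ?posrE// ler_nat.
by move: (N.+2%:R^-1 : R) => x; lra.
Qed.

Lemma theta_ge0 : 0 <= theta.
Proof. by rewrite (le_trans _ theta_ge_half)// invr_ge0. Qed.

Lemma euler_supported k : supported N (U k).
Proof.
elim: k => [|k [IH0 IHN]]; split => [c|c j Nj] /=.
- by rewrite u0_0.
- by rewrite leqNgt Nj.
- by rewrite IH0 /galerkin_rhs /= mulr0 addr0.
- by rewrite IHN// /galerkin_rhs [X in _ && X]leqNgt Nj andbF mulr0 addr0.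
Qed.

(** Expanding |U + h F|^2, the cross term is -h times the dissipation by the energy balance. The
    remainder h^2 |F|^2 is at most h times the dissipation divided by N+2, by the linear bound on F,
    [h_small] and the Poincaré inequality. *)
Lemma euler_energy_step k : sq N (U k) <= E0 ->
  sq N (U k.+1) <= sq N (U k) - theta * h * dissip N (U k).
Proof.
move=> kE; have su := euler_supported k; have bu := supported_bounded su kE.
have sq0 : 0 <= sq N (U k) by exact: weighted_sqsum_ge0.
have -> : sq N (U k.+1) = sq N (U k) +
    h * (2 * (\sum_(1 <= j < N.+1) \sum_(c : bool) U k c j * F c j (U k))) +
    h ^+ 2 * (\sum_(1 <= j < N.+1) \sum_(c : bool) F c j (U k) ^+ 2).
  rewrite /weighted_sqsum !mulr_sumr -!big_split /= !big_nat.
  apply: eq_bigr => j /andP[j0 jN].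
  rewrite !mulr_sumr -!big_split /=; apply: eq_bigr => c _.
  by rewrite /galerkin_rhs j0 -ltnS jN /=; ring.
rewrite F_balance; [|by case: su|by move=> c; case: su => _ ->].
have F2 : \sum_(1 <= j < N.+1) \sum_(c : bool) F c j (U k) ^+ 2 <=
    (\sum_(1 <= j < N.+1) \sum_(c : bool) K j ^+ 2) * sq N (U k).
  rewrite mulr_suml !big_nat; apply: ler_sum => j /andP[j0 jN].
  rewrite mulr_suml; apply: ler_sum => c _.
  have := galerkin_rhs_bound N c j bu (coord_le_sqrt su).
  rewrite /galerkin_rhs j0 -ltnS jN /= => FK.
  rewrite -[X in _ <= _ * X](sqr_sqrtr sq0) -exprMn -real_normK ?num_real//.
  by rewrite lerXn2r// nnegrE mulr_ge0// sqrtr_ge0.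
have := dissip_ge N (U k); move: F2 h_small.
move: (\sum_(1 <= j < N.+1) \sum_(c : bool) K j ^+ 2) => B.
move: (\sum_(1 <= j < N.+1) \sum_(c : bool) _) => S.
move: sq0; move: (sq N (U k)) (dissip N (U k)) => e D e0 F2 hB kD.
have n0 : 0 < (N.+2%:R : R) by [].
(* It remains to bound h^2 S by h D / (N+2), that is, h S (N+2) by D. *)
have -> : e - theta * h * D = e + h * (- D) + h * N.+2%:R^-1 * D by ring.
rewrite lerD2l expr2 -!mulrA ler_wpM2l ?(ltW h_gt0)//.
rewrite [leRHS]mulrC ler_pdivlMr// (le_trans _ kD)//.
have h0 := ltW h_gt0.
have := ler_wpM2r e0 hB.
suff : h * S * N.+2%:R <= h * B * N.+2%:R * e by lra.
have -> : h * B * N.+2%:R * e = h * (B * e) * N.+2%:R by ring.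
by rewrite ler_wpM2r// ?ler_wpM2l// ltW.
Qed.

Lemma euler_energy0 : sq N (U 0%N) <= E0.
Proof.
rewrite (le_trans _ (u0_E0 N))// /weighted_sqsum !big_nat.
by apply: ler_sum => j /andP[_]; rewrite ltnS /= => ->.
Qed.

Lemma euler_dissip_ge0 M k : 0 <= dissip M (U k).
Proof. exact: weighted_sqsum_ge0 w_ge0. Qed.

Lemma euler_energy_le k : sq N (U k) <= E0.
Proof.
elim: k => [|k IH]; first exact: euler_energy0.
rewrite (le_trans (euler_energy_step IH))// (le_trans _ IH)// gerBl.
by rewrite !mulr_ge0 ?theta_ge0 ?euler_dissip_ge0 ?(ltW h_gt0).
Qed.

Lemma euler_bounded k : state_bounded (1 + E0) (U k).
Proof. exact: supported_bounded (euler_supported k) (euler_energy_le k). Qed.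

Lemma euler_energy_sum k n :
  sq N (U (k + n)) <= sq N (U k) - theta * (h * \sum_(i < n) dissip N (U (k + i))).
Proof.
elim: n => [|n IH]; first by rewrite big_ord0 !mulr0 subr0 addn0.
rewrite addnS (le_trans (euler_energy_step (euler_energy_le _)))//.
rewrite big_ord_recr /= !mulrDr opprD addrA lerD ?IH//.
by rewrite lerN2 mulrA.
Qed.

Lemma euler_energy_anti k n : sq N (U (k + n)) <= sq N (U k).
Proof.
rewrite (le_trans (euler_energy_sum k n))// gerBl.
rewrite mulr_ge0 ?theta_ge0// mulr_ge0 ?(ltW h_gt0)//.
by apply: sumr_ge0 => i _; exact: euler_dissip_ge0.
Qed.

Lemma euler_increment k n c j :
  `|U (k + n) c j - U k c j| <= n%:R * h * (K j * (1 + E0)).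
Proof.
elim: n => [|n IH]; first by rewrite addn0 subrr normr0 !mul0r.
rewrite addnS /= addrAC (le_trans (ler_normD _ _))//.
rewrite -natr1 2!mulrDl mul1r lerD// normrM gtr0_norm// ler_wpM2l ?(ltW h_gt0)//.
by apply: galerkin_rhs_bound; exact: euler_bounded.
Qed.

(** A common bound on the speed of the coordinates up to m; the sum stands in for a maximum. *)
Definition window_speed m : R := \sum_(i < m.+1) K i * (1 + E0).

Lemma window_speed_ge0 m : 0 <= window_speed m.
Proof. by apply: sumr_ge0 => i _; rewrite mulr_ge0// addr_ge0. Qed.

Lemma euler_window_increment m k n i c j : (i <= n)%N -> (j <= m)%N ->
  `|U (k + i) c j - U k c j| <= n%:R * h * window_speed m.
Proof.
move=> iln jm; rewrite (le_trans (euler_increment _ _ _ _))//.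
rewrite ler_pM ?mulr_ge0 ?addr_ge0 ?(ltW h_gt0)//.
  by rewrite ler_wpM2r ?(ltW h_gt0)// ler_nat.
rewrite /window_speed (bigD1 (inord j : 'I_m.+1))//= inordK// lerDl.
by apply: sumr_ge0 => ? _; rewrite mulr_ge0// addr_ge0.
Qed.

Lemma euler_second_order k n c j : (0 < j <= N)%N ->
  `|U (k + n) c j - U k c j - n%:R * h * F c j (U k)|
    <= (n%:R * h) ^+ 2 * (K j * window_speed j.+1).
Proof.
move=> jN; set L := K j * _.
have L0 : 0 <= L by rewrite mulr_ge0// window_speed_ge0.
(* The induction is on i with n fixed: at each of the steps the state is within n h times the window
   speed of [U k], so F has moved by at most n h L. *)
suff H i : (i <= n)%N -> `|U (k + i) c j - U k c j - i%:R * h * F c j (U k)|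
    <= i%:R * h * (n%:R * h * L) by rewrite (le_trans (H _ (leqnn n)))// expr2 mulrA.
elim: i => [|i IH] iln; first by rewrite addn0 subrr !mul0r subr0 normr0.
have -> : U (k + i.+1) c j - U k c j - i.+1%:R * h * F c j (U k) =
    (U (k + i) c j - U k c j - i%:R * h * F c j (U k)) +
    h * (galerkin_rhs N c j (U (k + i)) - galerkin_rhs N c j (U k)).
  by rewrite addnS /= /galerkin_rhs jN -natr1; ring.
rewrite (le_trans (ler_normD _ _))// -[i.+1%:R]natr1 2!mulrDl mul1r.
rewrite lerD ?IH ?(ltnW iln)// normrM gtr0_norm// ler_wpM2l ?(ltW h_gt0)//.
rewrite /L mulrCA; apply: galerkin_rhs_lip; [exact: euler_bounded..|].
by move=> c' i' i'j; apply: euler_window_increment => //; exact: ltnW.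
Qed.

Lemma euler_observable (f : state -> R) (C : R) m k n i :
  (forall u v d, state_bounded (1 + E0) u -> state_bounded (1 + E0) v ->
    (forall c i, (i <= m)%N -> `|u c i - v c i| <= d) -> `|f u - f v| <= C * d) ->
  (i <= n)%N ->
  `|f (U (k + i)) - f (U k)| <= C * (n%:R * h * window_speed m).
Proof.
move=> Cf iln; apply: Cf; [exact: euler_bounded..|].
by move=> c j jm; exact: euler_window_increment.
Qed.

(** Only the dissipation of the first M shells at the initial time is kept: this observable passes
    to the limit in N, and freezing it in time costs an error quadratic in n h. *)
Lemma euler_energy_drop (C : R) M k n : (M <= N)%N ->
  (forall u v d, state_bounded (1 + E0) u -> state_bounded (1 + E0) v ->
    (forall c i, (i <= M)%N -> `|u c i - v c i| <= d) ->
    `|dissip M u - dissip M v| <= C * d) ->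
  sq N (U (k + n)) <= sq N (U k) -
    theta * (n%:R * h * (dissip M (U k) - C * (n%:R * h * window_speed M))).
Proof.
move=> MN HC; rewrite (le_trans (euler_energy_sum k n))// lerD2l lerN2.
rewrite ler_wpM2l ?theta_ge0//.
rewrite [n%:R * h]mulrC -mulrA ler_wpM2l ?(ltW h_gt0)//.
rewrite mulr_natl -[X in _ *+ X]card_ord -sumr_const; apply: ler_sum => i _.
rewrite (le_trans _ (weighted_sqsum_widen _ w_ge0 MN))//.
have := euler_observable k HC (ltnW (ltn_ord i)).
by rewrite mulrAC ler_norml [h * _]mulrC => /andP[+ _]; lra.
Qed.

(** The final energy is below the energy at each intermediate step, to which [sq_tail] applies.
    Summed over the steps, the dissipation is at most twice the energy drop, because [theta] is at
    least 1/2. *)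
Lemma euler_energy_tail (C eps : R) M k n : (M <= N)%N -> 0 <= eps ->
  (forall c j, (M < j)%N -> 1 <= eps * w c j) ->
  (forall u v d, state_bounded (1 + E0) u -> state_bounded (1 + E0) v ->
    (forall c i, (i <= M)%N -> `|u c i - v c i| <= d) ->
    `|sq M u - sq M v| <= C * d) ->
  n%:R * h * sq N (U (k + n)) <=
    n%:R * h * (sq M (U k) + C * (n%:R * h * window_speed M)) +
    2 * eps * (sq N (U k) - sq N (U (k + n))).
Proof.
move=> MN e0 Hw HC.
have D0 : 0 <= h * \sum_(i < n) dissip N (U (k + i)).
  by rewrite mulr_ge0 ?(ltW h_gt0)//; apply: sumr_ge0 => i _; exact: euler_dissip_ge0.
have De : h * \sum_(i < n) dissip N (U (k + i)) <=
    2 * (sq N (U k) - sq N (U (k + n))).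
  have := euler_energy_sum k n; have := ler_wpM2r D0 theta_ge_half.
  move: theta (h * \sum_(i < n) _) => th D /=; lra.
rewrite [2 * eps * _]mulrAC [_ * eps]mulrC.
apply: (le_trans _ (lerD (lexx _) (ler_wpM2l e0 De))).
rewrite [eps * _]mulrCA -!mulrA !(mulrCA n%:R h) -mulrDr ler_wpM2l ?(ltW h_gt0)//.
have cst (x : R) : n%:R * x = \sum_(i < n) x by rewrite sumr_const card_ord mulr_natl.
rewrite [eps * \sum_(i < n) _]mulr_sumr (cst (sq N _)) (cst (sq M _ + _)).
rewrite -big_split /=; apply: ler_sum => i _.
have -> : (k + n = k + i + (n - i))%N by rewrite -addnA subnKC// ltnW.
rewrite (le_trans (euler_energy_anti _ _))//.
rewrite (le_trans (sq_tail _ e0 Hw MN))// lerD2r.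
have := euler_observable k HC (ltnW (ltn_ord i)).
by rewrite ler_norml => /andP[_]; lra.
Qed.

End FixedStep.
End GalerkinEuler.

(** * The ultrafilter limit *)

(** The image of G contains a compact segment, hence has a cluster point l. For a neighbourhood V of
    l the ultrafilter contains the preimage of V or its complement, and the latter contradicts
    clustering. *)
Lemma ultrafilter_bounded_cvg (R : realType) (G : set_system nat) (x : nat -> R)
    (B : R) : UltraFilter G -> (forall n, `|x n| <= B) ->
  exists l : R, x n @[n --> G] --> l.
Proof.
move=> UG xB; have PG : ProperFilter G by exact: ultra_proper.
have /= := @segment_compact R (- B) B (x @ G) _.
case.
  by near=> n; rewrite /= in_itv /= -ler_norml.
move=> l [_ cl]; exists l => V Vl.
have [//|GV] := in_ultra_setVsetC (x @^-1` V) UG.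
by have [y [/= ]] := cl (~` V) V GV Vl.
Unshelve. all: by end_near. Qed.

(** Finitely many coordinates matter, so their separate convergences hold on one common set of the
    filter. Dividing by K + 1 covers K = 0. *)
Lemma lipschitz_window_cvg (R : realType) (r : R) m (f : (bool -> nat -> R) -> R)
    (G : set_system nat) (x : nat -> bool -> nat -> R) p :
  Filter G -> lipschitz_window r m f -> (forall n, state_bounded r (x n)) ->
  state_bounded r p -> (forall c i, x n c i @[n --> G] --> p c i) ->
  f (x n) @[n --> G] --> f p.
Proof.
move=> FG [K K0 Kf] xr pr xp; apply/cvgrPdist_le => e e0.
have K1 : 0 < K + 1 by rewrite ltr_wpDl.
have xpe : \forall n \near G, forall ci : bool * 'I_m.+1,
    `|p ci.1 ci.2 - x n ci.1 ci.2| <= e / (K + 1).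
  by apply: filter_forall => ci; apply: cvgr_dist_le => //; rewrite divr_gt0.
near=> n.
have H : `|f p - f (x n)| <= K * (e / (K + 1)).
  apply: Kf => // c i im.
  by move: (near xpe n) => /(_ _ (c, Ordinal (im : (i < m.+1)%N))); apply.
rewrite (le_trans H)// mulrCA ger_pMr// ler_pdivrMr// mul1r lerDl//.
Unshelve. all: by end_near. Qed.

Section GalerkinLimit.
Variables (R : realType) (F : bool -> nat -> (bool -> nat -> R) -> R).
Variables (w : bool -> nat -> R) (u0 : bool -> nat -> R) (E0 kappa : R).

Local Notation state := (bool -> nat -> R).
Local Notation sq := (weighted_sqsum (fun _ _ => 1)).
Local Notation dissip := (weighted_sqsum w).

Hypothesis E0_ge0 : 0 <= E0.
Hypothesis kappa_gt0 : 0 < kappa.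
Hypothesis w_ge : forall c j, kappa <= w c j.
Hypothesis w_unbounded : forall eps : R, 0 < eps ->
  exists M, forall c j, (M < j)%N -> 1 <= eps * w c j.
Hypothesis u0_0 : forall c, u0 c 0%N = 0.
Hypothesis u0_E0 : forall N, sq N u0 <= E0.
Hypothesis F_0 : forall c j, F c j (fun _ _ => 0) = 0.
Hypothesis F_balance : forall N (u : state), (forall c, u c 0%N = 0) ->
  (forall c, u c N.+1 = 0) ->
  2 * (\sum_(1 <= j < N.+1) \sum_(c : bool) u c j * F c j u) = - dissip N u.
Hypothesis F_lip : forall c j, lipschitz_window (1 + E0) j.+1 (F c j).

Lemma uniform_lipschitz_bound : exists2 K : nat -> R, (forall j, 0 <= K j) &
  forall c j (u v : state) (d : R),
  state_bounded (1 + E0) u -> state_bounded (1 + E0) v ->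
  (forall c i, (i <= j.+1)%N -> `|u c i - v c i| <= d) ->
  `|F c j u - F c j v| <= K j * d.
Proof.
have H j : exists K, 0 <= K /\ forall c (u v : state) (d : R),
    state_bounded (1 + E0) u -> state_bounded (1 + E0) v ->
    (forall c i, (i <= j.+1)%N -> `|u c i - v c i| <= d) ->
    `|F c j u - F c j v| <= K * d.
  have [K K0 HK] := F_lip true j; have [L L0 HL] := F_lip false j.
  exists (K + L); split; first exact: addr_ge0.
  move=> [] u v d bu bv uv; have d0 := window_radius_ge0 uv.
    by rewrite (le_trans (HK _ _ _ bu bv uv))// ler_wpM2r// lerDl.
  by rewrite (le_trans (HL _ _ _ bu bv uv))// ler_wpM2r// lerDr.
have [K HK] := choice H.
exists K => [j|c j u v d]; first by have [] := HK j.
by have [_ ] := HK j; exact.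
Qed.

(** * Passage to the limit of the piecewise constant approximations *)

Section Limit.
Variables (K : nat -> R) (G : set_system nat).
Hypothesis K_ge0 : forall j, 0 <= K j.
Hypothesis K_lip : forall c j (u v : state) (d : R),
  state_bounded (1 + E0) u -> state_bounded (1 + E0) v ->
  (forall c i, (i <= j.+1)%N -> `|u c i - v c i| <= d) ->
  `|F c j u - F c j v| <= K j * d.
Hypothesis G_proper : ProperFilter G.
Hypothesis G_cofinite : \oo `<=` G.

(** The sum in the denominator meets the smallness condition of the energy step. The summand
    [1 + kappa] keeps the denominator positive and, with the factor N+2, puts the step below
    1/(N+1), so that it tends to 0. *)
Definition time_step N : R :=
  kappa / (((\sum_(1 <= j < N.+1) \sum_(c : bool) K j ^+ 2) + (1 + kappa)) * N.+2%:R).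

Lemma sum_K_ge0 N : 0 <= \sum_(1 <= j < N.+1) \sum_(c : bool) K j ^+ 2.
Proof. by apply: sumr_ge0 => j _; apply: sumr_ge0 => c _; exact: sqr_ge0. Qed.

Lemma time_step_gt0 N : 0 < time_step N.
Proof. by rewrite divr_gt0// mulr_gt0// ltr_wpDl ?sum_K_ge0// addr_gt0. Qed.

Lemma time_step_small N : time_step N *
  (\sum_(1 <= j < N.+1) \sum_(c : bool) K j ^+ 2) * N.+2%:R <= kappa.
Proof.
rewrite /time_step; have := sum_K_ge0 N; move: (\sum_(1 <= j < N.+1) _) => B B0.
have B1 : 0 < B + (1 + kappa) by rewrite ltr_wpDl// addr_gt0.
have -> : kappa / ((B + (1 + kappa)) * N.+2%:R) * B * N.+2%:R =
  kappa * (B / (B + (1 + kappa))).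
  by field; rewrite gt_eqF//= gt_eqF// ltr_pwDl.
rewrite ger_pMr// ler_pdivrMr// mul1r lerDl.
by rewrite addr_ge0// ltW.
Qed.

Lemma time_step_le N : time_step N <= N.+1%:R^-1.
Proof.
rewrite /time_step; have := sum_K_ge0 N; move: (\sum_(1 <= j < N.+1) _) => B B0.
have B1 : 0 < B + (1 + kappa) by rewrite ltr_wpDl// addr_gt0.
rewrite ler_pdivrMr ?mulr_gt0// mulrCA.
rewrite (@le_trans _ _ (B + (1 + kappa)))//; first by rewrite addrA lerDr addr_ge0.
by rewrite ler_peMr ?(ltW B1)// ler_pdivlMl// mulr1 ler_nat.
Qed.

Lemma time_step_cvg0 : time_step N @[N --> G] --> (0 : R).
Proof.
apply: (squeeze_cvgr (f := fun=> 0) (h := @harmonic R)).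
- by near=> N; rewrite ltW ?time_step_gt0//= time_step_le.
- exact: cvg_cst.
- by move=> V /(@cvg_harmonic R); exact: G_cofinite.
Unshelve. all: by end_near. Qed.

(* [truncn] vanishes on negative reals, so the approximations are extended by
   their initial value to negative times. *)
Definition step_index N (t : R) : nat := Num.truncn (t / time_step N).

Definition galerkin_approx N (t : R) : state :=
  euler F u0 N (time_step N) (step_index N t).

Definition elapsed N (t s : R) : R :=
  (step_index N s - step_index N t)%:R * time_step N.

Lemma step_index_le N t s : t <= s -> (step_index N t <= step_index N s)%N.
Proof.
by move=> ts; apply: Num.Theory.le_truncn; rewrite ler_wpM2r// invr_ge0 ltW// time_step_gt0.
Qed.

Lemma step_time_cvg t : 0 <= t -> (step_index N t)%:R * time_step N @[N --> G] --> t.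
Proof.
move=> t0; apply: (squeeze_cvgr (f := fun N => t - time_step N) (h := fun=> t)).
- near=> N; have h0 := time_step_gt0 N.
  have q0 : 0 <= t / time_step N by rewrite divr_ge0// ltW.
  have := Num.Theory.truncn_itv q0; rewrite -/(step_index N t).
  rewrite ler_pdivlMr// ltr_pdivrMr// -natr1 mulrDl mul1r => /andP[-> /ltW].
  by rewrite -lerBlDr => ->.
- by rewrite -[X in _ --> X]subr0; apply: cvgB; [exact: cvg_cst|exact: time_step_cvg0].
- exact: cvg_cst.
Unshelve. all: by end_near. Qed.

Lemma elapsed_cvg t s : 0 <= t -> t <= s -> elapsed N t s @[N --> G] --> s - t.
Proof.
move=> t0 ts; rewrite /elapsed.
under eq_fun => N do rewrite natrB ?step_index_le// mulrBl.
by apply: cvgB; apply: step_time_cvg => //; exact: le_trans ts.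
Qed.

Lemma galerkin_approx_later N t s : t <= s -> galerkin_approx N s =
  euler F u0 N (time_step N) (step_index N t + (step_index N s - step_index N t)).
Proof. by move=> ts; rewrite subnKC ?step_index_le. Qed.

Lemma galerkin_approx_bounded N t : state_bounded (1 + E0) (galerkin_approx N t).
Proof.
exact: (euler_bounded E0_ge0 kappa_gt0 w_ge u0_0 u0_E0 F_0 F_balance K_ge0 K_lip
  (time_step_gt0 N) (time_step_small N)).
Qed.

Lemma galerkin_energy_le N t : sq N (galerkin_approx N t) <= E0.
Proof.
exact: (euler_energy_le E0_ge0 kappa_gt0 w_ge u0_0 u0_E0 F_0 F_balance K_ge0 K_lip
  (time_step_gt0 N) (time_step_small N)).
Qed.

Variables (p : R -> state) (E : R -> R).
Hypothesis p_lim : forall t c j, galerkin_approx N t c j @[N --> G] --> p t c j.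
Hypothesis E_lim : forall t, sq N (galerkin_approx N t) @[N --> G] --> E t.

Lemma eventually_ge (m : nat) : \forall N \near G, (m <= N)%N.
Proof. by apply: G_cofinite; exact: nbhs_infty_ge. Qed.

Lemma limit_bounded t : state_bounded (1 + E0) (p t).
Proof.
move=> c j; apply: (ler_cvg_to (cvg_norm (@p_lim t c j)) (cvg_cst _)).
by near=> N; exact: galerkin_approx_bounded.
Unshelve. all: by end_near. Qed.

Lemma limit_observable r m (f : state -> R) t : r = 1 + E0 ->
  lipschitz_window r m f -> f (galerkin_approx N t) @[N --> G] --> f (p t).
Proof.
move=> -> fL; apply: (lipschitz_window_cvg _ fL) => [N||c i].
- exact: galerkin_approx_bounded.
- exact: limit_bounded.
- exact: (@p_lim).
Qed.

Lemma limit_coord0 t c : p t c 0%N = 0.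
Proof.
apply: (cvg_unique _ (@p_lim t c 0%N)) => //.
rewrite (_ : (fun N => _) = fun=> 0); first exact: cvg_cst.
apply/funext => N; have [H _] := euler_supported F u0_0 N (time_step N) (step_index N t).
exact: H.
Qed.

Lemma limit_init t : t <= 0 -> p t = u0.
Proof.
move=> t0; apply/funext => c; apply/funext => j.
apply: (cvg_unique _ (@p_lim t c j)) => //.
apply: cvg_near_cst.
near=> N; rewrite /galerkin_approx.
have -> : step_index N t = 0%N.
  apply/eqP; rewrite -leqn0; apply: (leq_trans (step_index_le _ t0)).
  by rewrite /step_index mul0r Num.Theory.truncn0.
by rewrite /= (_ : (j <= N)%N)//; near: N; exact: eventually_ge.
Unshelve. all: by end_near. Qed.

(** The shells up to M are part of the truncation once N >= M. Energy may escape to high shells in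
    the limit, so this is only an inequality. *)
Lemma limit_sq_le M t : sq M (p t) <= E t.
Proof.
have sqL := lipschitz_window_sqsum (1 + E0) (fun _ _ => 1) M.
apply: (ler_cvg_to (@limit_observable _ _ _ t erefl sqL) (@E_lim t)).
near=> N; apply: weighted_sqsum_widen => //; near: N; exact: eventually_ge.
Unshelve. all: by end_near. Qed.

Lemma limit_energy_le t : E t <= E0.
Proof.
apply: (ler_cvg_to (@E_lim t) (cvg_cst _)).
by near=> N; exact: galerkin_energy_le.
Unshelve. all: by end_near. Qed.

Lemma limit_energy_anti t s : t <= s -> E s <= E t.
Proof.
move=> ts; apply: (ler_cvg_to (@E_lim s) (@E_lim t)).
near=> N; rewrite (galerkin_approx_later N ts).
exact: (euler_energy_anti E0_ge0 kappa_gt0 w_ge u0_0 u0_E0 F_0 F_balance K_ge0 K_lip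
  (time_step_gt0 N) (time_step_small N)).
Unshelve. all: by end_near. Qed.

Lemma limit_second_order c j : (0 < j)%N -> exists2 C, 0 <= C &
  forall t s, 0 <= t -> t <= s ->
  `|p s c j - p t c j - (s - t) * F c j (p t)| <= (s - t) ^+ 2 * C.
Proof.
move=> j0; exists (K j * window_speed E0 K j.+1).
  by rewrite mulr_ge0// window_speed_ge0.
move=> t s t0 ts; have el := elapsed_cvg t0 ts.
have el2 : elapsed N t s ^+ 2 @[N --> G] --> (s - t) ^+ 2 by exact: cvgM.
set C := K j * _.
have rhs : elapsed N t s ^+ 2 * C @[N --> G] --> (s - t) ^+ 2 * C.
  by apply: cvgM; [exact: el2|exact: cvg_cst].
have lhs : `|galerkin_approx N s c j - galerkin_approx N t c j -
      elapsed N t s * F c j (galerkin_approx N t)| @[N --> G]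
    --> `|p s c j - p t c j - (s - t) * F c j (p t)|.
  apply: cvg_norm; apply: cvgB; first by apply: cvgB; exact: (@p_lim).
  apply: cvgM; first exact: el.
  exact: (@limit_observable _ _ _ t erefl (F_lip c j)).
apply: (ler_cvg_to lhs rhs).
near=> N; rewrite /= (galerkin_approx_later N ts).
apply: (euler_second_order E0_ge0 kappa_gt0 w_ge u0_0 u0_E0 F_0 F_balance K_ge0 K_lip
  (time_step_gt0 N) (time_step_small N)).
by rewrite j0 /=; near: N; exact: eventually_ge.
Unshelve. all: by end_near. Qed.

Lemma limit_energy_drop M : exists L : R, forall t s, 0 <= t -> t <= s ->
  E s <= E t - (s - t) * (dissip M (p t) - (s - t) * L).
Proof.
have dL := lipschitz_window_sqsum (1 + E0) w M; have [C C0 HC] := dL.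
exists (C * window_speed E0 K M) => t s t0 ts; have el := elapsed_cvg t0 ts.
set L := C * _; pose theta N : R := 1 - N.+2%:R^-1.
(* The share 1/(N+2) lost to the discretisation disappears, so the limit has the full dissipation
   coefficient. *)
have theta_cvg : theta N @[N --> G] --> (1 : R).
  rewrite -[X in _ --> X]subr0; apply: cvgB; first exact: cvg_cst.
  apply: (squeeze_cvgr (f := fun=> 0) (h := @harmonic R)).
  - by near=> N; rewrite invr_ge0 ler0n/= lef_pV2 ?posrE// ler_nat.
  - exact: cvg_cst.
  - by move=> V /(@cvg_harmonic R); exact: G_cofinite.
have rhs : sq N (galerkin_approx N t) - theta N * (elapsed N t s *
      (dissip M (galerkin_approx N t) - elapsed N t s * L)) @[N --> G]
    --> E t - (s - t) * (dissip M (p t) - (s - t) * L).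
  apply: cvgB; first exact: (@E_lim).
  rewrite -[X in _ --> X]mul1r; apply: cvgM; first exact: theta_cvg.
  apply: cvgM; first exact: el.
  apply: cvgB; first exact: (@limit_observable _ _ _ t erefl dL).
  by apply: cvgM; [exact: el|exact: cvg_cst].
apply: (ler_cvg_to (@E_lim s) rhs).
near=> N; rewrite (galerkin_approx_later N ts) [elapsed N t s * L]mulrCA.
apply: (euler_energy_drop E0_ge0 kappa_gt0 w_ge u0_0 u0_E0 F_0 F_balance K_ge0 K_lip
  (time_step_gt0 N) (time_step_small N) _ _ _ HC).
by near: N; exact: eventually_ge.
Unshelve. all: by end_near. Qed.

(* The tail beyond M costs eps times the dissipation, which the energy drop
   [E t - E s] controls. *)
Lemma limit_energy_tail (eps : R) : 0 < eps -> exists M (L : R),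
  forall t s, 0 <= t -> t <= s ->
  (s - t) * E s <= (s - t) * (sq M (p t) + (s - t) * L) + eps * (E t - E s).
Proof.
(* Half of eps, because [euler_energy_tail] has a factor 2. *)
move=> e0; have e20 : 0 < eps / 2 by rewrite divr_gt0.
have [M HM] := w_unbounded e20.
have dL := lipschitz_window_sqsum (1 + E0) (fun _ _ => 1) M; have [C C0 HC] := dL.
exists M, (C * window_speed E0 K M) => t s t0 ts; have el := elapsed_cvg t0 ts.
set L := C * _.
have lhs : elapsed N t s * sq N (galerkin_approx N s) @[N --> G] --> (s - t) * E s.
  by apply: cvgM; [exact: el|exact: (@E_lim)].
have rhs : elapsed N t s * (sq M (galerkin_approx N t) + elapsed N t s * L) +
      eps * (sq N (galerkin_approx N t) - sq N (galerkin_approx N s)) @[N --> G]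
    --> (s - t) * (sq M (p t) + (s - t) * L) + eps * (E t - E s).
  apply: cvgD; apply: cvgM; [exact: el| |exact: cvg_cst|].
    apply: cvgD; first exact: (@limit_observable _ _ _ t erefl dL).
    by apply: cvgM; [exact: el|exact: cvg_cst].
  by apply: cvgB; exact: (@E_lim).
apply: (ler_cvg_to lhs rhs).
near=> N; rewrite (galerkin_approx_later N ts) [elapsed N t s * L]mulrCA.
rewrite -[X in X * (_ - _)](divfK (_ : 2 != 0) eps)// [eps / 2 * 2]mulrC.
apply: (euler_energy_tail E0_ge0 kappa_gt0 w_ge u0_0 u0_E0 F_0 F_balance K_ge0 K_lip
  (time_step_gt0 N) (time_step_small N) _ _ _ (ltW e20) HM HC).
by near: N; exact: eventually_ge.
Unshelve. all: by end_near. Qed.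

End Limit.

(** The approximations are forgotten from here on: all later arguments rest on these increment
    estimates for p and E. *)
Lemma galerkin_limit : exists (p : R -> state) (E : R -> R),
  [/\ (forall t, state_bounded (1 + E0) (p t)) /\ (forall t c, p t c 0%N = 0),
      forall t, t <= 0 -> p t = u0,
      [/\ forall M t, sq M (p t) <= E t, forall t, E t <= E0 &
        forall t s, t <= s -> E s <= E t],
      forall c j, (0 < j)%N -> exists2 C : R, 0 <= C &
        forall t s, 0 <= t -> t <= s ->
        `|p s c j - p t c j - (s - t) * F c j (p t)| <= (s - t) ^+ 2 * C &
      (forall M, exists L : R, forall t s, 0 <= t -> t <= s ->
        E s <= E t - (s - t) * (dissip M (p t) - (s - t) * L)) /\
      (forall eps : R, 0 < eps -> exists M (L : R), forall t s, 0 <= t -> t <= s ->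
        (s - t) * E s <= (s - t) * (sq M (p t) + (s - t) * L) + eps * (E t - E s))].
Proof.
have [K K0 KL] := uniform_lipschitz_bound.
have [G [UG coG]] := @ultraFilterLemma nat \oo _.
have PG : ProperFilter G by exact: ultra_proper.
have pH t : exists pt : state, forall c j, galerkin_approx K N t c j @[N --> G] --> pt c j.
  have H c j : exists l : R, galerkin_approx K N t c j @[N --> G] --> l.
    apply: (ultrafilter_bounded_cvg (B := 1 + E0)) => N.
    exact: galerkin_approx_bounded.
  exists (fun c j => projT1 (cid (H c j))) => c j.
  by case: cid.
have EH t : exists l : R, sq N (galerkin_approx K N t) @[N --> G] --> l.
  apply: (ultrafilter_bounded_cvg (B := E0)) => N.
  by rewrite ger0_norm ?weighted_sqsum_ge0//; exact: galerkin_energy_le.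
have [p Hp] := choice pH; have [E HE] := choice EH.
exists p, E; split.
- by split=> [t|t c]; [exact: (limit_bounded K0 KL PG Hp)|exact: (limit_coord0 PG Hp)].
- by move=> t; exact: (limit_init PG coG Hp).
- split.
  + by move=> M t; exact: (limit_sq_le K0 KL PG coG Hp HE).
  + by move=> t; exact: (limit_energy_le K0 KL PG HE).
  + by move=> t s; exact: (limit_energy_anti K0 KL PG HE).
- by move=> c j; exact: (limit_second_order K0 KL PG coG Hp).
- split.
  + by move=> M; exact: (limit_energy_drop K0 KL PG coG Hp HE).
  + by move=> eps; exact: (limit_energy_tail K0 KL PG coG Hp HE).
Qed.

End GalerkinLimit.

(** * Quadratic increments and integrals *)

(* On a uniform subdivision of [a, b] into n steps the increments add up to at
   most (b - a) / n * (W b - W a). *)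
Lemma nonincreasing_of_quadratic_increments (R : realType) (H W : R -> R) (a b : R) :
  a <= b -> (forall t s, a <= t -> t <= s -> s <= b ->
    H s - H t <= (s - t) * (W s - W t)) -> H b <= H a.
Proof.
move=> ab HW; rewrite leNgt; apply/negP => Hab.
have bound n : (H b - H a) * n.+1%:R <= (b - a) * (W b - W a).
  pose x i := a + i%:R * ((b - a) / n.+1%:R).
  have d0 : 0 <= (b - a) / n.+1%:R by rewrite divr_ge0 ?subr_ge0.
  have step i : (i <= n.+1)%N ->
      H (x i) - H a <= (b - a) / n.+1%:R * (W (x i) - W a).
    elim: i => [|i IH] iln; first by rewrite /x mul0r addr0 !subrr mulr0.
    have xS : x i.+1 - x i = (b - a) / n.+1%:R by rewrite /x -natr1; ring.
    have xle : x i <= x i.+1 by rewrite -subr_ge0 xS.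
    have ax : a <= x i by rewrite lerDl mulr_ge0.
    have xb : x i.+1 <= b.
      rewrite /x -lerBrDl mulrCA ger_pMr ?subr_gt0; last first.
        by rewrite lt_neqAle ab andbT; apply: contraTneq Hab => ->; rewrite ltxx.
      by rewrite ler_pdivrMr// mul1r ler_nat.
    have := HW _ _ ax xle xb; rewrite xS; have := IH (ltnW iln).
    move: (_ / _) => d; lra.
  have xn : x n.+1 = b by rewrite /x mulrCA divff ?mulr1 ?pnatr_eq0// addrC subrK.
  have := step _ (leqnn _); rewrite xn mulrAC.
  by rewrite ler_pdivlMr.
have d0 : 0 < H b - H a by rewrite subr_gt0.
(* For this n, n + 1 exceeds the quotient, which contradicts [bound]. *)
have := bound (Num.truncn ((b - a) * (W b - W a) / (H b - H a))).
rewrite leNgt => /negP; apply; rewrite [ltRHS]mulrC -ltr_pdivrMr//.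
exact: Num.Theory.truncnS_gt.
Qed.

Lemma lipschitz_continuous (R : realType) (f : R -> R) (L : R) :
  (forall t s, t <= s -> `|f s - f t| <= (s - t) * L) -> continuous f.
Proof.
move=> fL t; apply/cvgrPdist_le => e e0.
have L1 : 0 < `|L| + 1 by rewrite ltr_wpDl.
have : \forall s \near t, `|t - s| <= e / (`|L| + 1).
  have /cvgrPdist_le : x @[x --> t] --> t by exact: cvg_id.
  by apply; rewrite divr_gt0.
apply: filterS => s ts.
have H : `|f t - f s| <= `|t - s| * `|L|.
  case: (leP t s) => [h|/ltW h].
    rewrite distrC (le_trans (fL _ _ h))// distrC [`|s - t|]ger0_norm ?subr_ge0//.
    by rewrite ler_wpM2l ?subr_ge0// ler_norm.
  rewrite (le_trans (fL _ _ h))// [`|t - s|]ger0_norm ?subr_ge0//.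
  by rewrite ler_wpM2l ?subr_ge0// ler_norm.
rewrite (le_trans H)// (le_trans (ler_wpM2r (normr_ge0 L) ts))//.
rewrite mulrAC -mulrA ger_pMr// ler_pdivrMr// mul1r lerDl//.
Qed.

Lemma is_derive_within_quadratic (R : realType) (f g : R -> R) (C : R) (A : set R) (t : R) :
  (forall s, A s -> `|f s - f t - (s - t) * g t| <= (s - t) ^+ 2 * C) ->
  is_derive_within A f t (g t).
Proof.
move=> fg; apply/cvgrPdist_le => e e0.
have C1 : 0 < `|C| + 1 by rewrite ltr_wpDl.
have : \forall s \near t, `|t - s| <= e / (`|C| + 1).
  have /cvgrPdist_le : x @[x --> t] --> t by exact: cvg_id.
  by apply; rewrite divr_gt0.
rewrite /within /= /dnbhs; apply: filterS => s ts /= /eqP st As.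
have st0 : s - t != 0 by rewrite subr_eq0; apply/eqP.
have -> : g t - (f s - f t) / (s - t) = - (f s - f t - (s - t) * g t) / (s - t).
  by field.
rewrite normrM normrN normfV ler_pdivrMr ?normr_gt0// (le_trans (fg s As))//.
rewrite -real_normK ?num_real// expr2 -mulrA mulrC ler_wpM2r//.
rewrite (le_trans (ler_norm _))// normrM normr_id [`|s - t|]distrC.
rewrite (le_trans (ler_wpM2r (normr_ge0 C) ts))//.
by rewrite mulrAC -mulrA ger_pMr// ler_pdivrMr// mul1r lerDl.
Qed.

(** * Integrals of bounded measurable functions *)

Section IntegralFunction.
Variables (R : realType) (g : R -> R) (B : R).
Hypothesis g_measurable : measurable_fun setT g.
Hypothesis g_bounded : forall t, `|g t| <= B.

Definition integral_from0 (t : R) : R := \int[lebesgue_measure]_(x in `[0, t]) g x.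

Lemma bounded_integrable_itv (i : interval R) (a b : R) :
  [set` i] `<=` `[a, b] -> lebesgue_measure.-integrable [set` i] (EFin \o g).
Proof.
move=> iab; apply: measurable_bounded_integrable => //.
- apply: (@le_lt_trans _ _ (lebesgue_measure `[a, b])).
    by apply: le_measure => //; rewrite inE.
  by rewrite lebesgue_measure_itv /=; case: ifP => _; rewrite ltry.
- exact: measurable_funS g_measurable.
- exists B; split; first exact: num_real.
  by move=> M BM t _ /=; rewrite (le_trans (g_bounded t))// ltW.
Qed.

Lemma integral_from0_incr (t s : R) : 0 <= t -> t <= s ->
  integral_from0 s - integral_from0 t = \int[lebesgue_measure]_(x in `]t, s]) g x.
Proof.
move=> t0 ts; rewrite /integral_from0 Rintegral_itvB ?bnd_simp//.
exact: (@bounded_integrable_itv _ 0 s).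
Qed.

Lemma subset_itv_oc_cc (t s : R) : [set` `]t, s]] `<=` `[t, s].
Proof. by move=> x /=; rewrite !in_itv /= => /andP[/ltW -> ->]. Qed.

Lemma Rintegral_cst_itv_oc (t s M : R) : t <= s ->
  \int[lebesgue_measure]_(x in `]t, s]) M = (s - t) * M.
Proof.
rewrite le_eqVlt Rintegral_cst//= lebesgue_measure_itv /= lte_fin mulrC.
by move=> /predU1P[->|->]//; rewrite ltxx subrr.
Qed.

Lemma integrable_cst_itv_oc (t s M : R) :
  lebesgue_measure.-integrable `]t, s] (EFin \o (fun=> M : R)).
Proof.
apply: measurable_bounded_integrable => //.
  by rewrite /= lebesgue_measure_itv /=; case: ifP => _; rewrite ltry.
exists `|M|; split; first exact: num_real.
by move=> N MN x _ /=; rewrite ltW.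
Qed.

Lemma integral_from0_incr_le (t s M : R) : 0 <= t -> t <= s ->
  (forall x, t <= x <= s -> g x <= M) ->
  integral_from0 s - integral_from0 t <= (s - t) * M.
Proof.
move=> t0 ts gM; rewrite integral_from0_incr// -Rintegral_cst_itv_oc//.
apply: le_Rintegral => //.
- exact: bounded_integrable_itv (@subset_itv_oc_cc _ _).
- exact: integrable_cst_itv_oc.
- by move=> x /subset_itv_oc_cc /=; rewrite in_itv; exact: gM.
Qed.

Lemma integral_from0_incr_ge (t s M : R) : 0 <= t -> t <= s ->
  (forall x, t <= x <= s -> M <= g x) ->
  (s - t) * M <= integral_from0 s - integral_from0 t.
Proof.
move=> t0 ts gM; rewrite integral_from0_incr// -Rintegral_cst_itv_oc//.
apply: le_Rintegral => //.
- exact: integrable_cst_itv_oc.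
- exact: bounded_integrable_itv (@subset_itv_oc_cc _ _).
- by move=> x /subset_itv_oc_cc /=; rewrite in_itv; exact: gM.
Qed.

Lemma integral_from0_0 : integral_from0 0 = 0.
Proof. by rewrite /integral_from0 set_itv1 Rintegral_set1. Qed.

End IntegralFunction.

(** * Regularity and energy of the limit *)

Section LimitRegularity.
Variables (R : realType) (F : bool -> nat -> (bool -> nat -> R) -> R).
Variables (u0 : bool -> nat -> R) (r : R) (p : R -> bool -> nat -> R).
Local Notation state := (bool -> nat -> R).

Hypothesis F_lip : forall c j, lipschitz_window r j.+1 (F c j).
Hypothesis p_bounded : forall t, state_bounded r (p t).
Hypothesis p_0 : forall t c, p t c 0%N = 0.
Hypothesis p_init : forall t, t <= 0 -> p t = u0.
Hypothesis p_second_order : forall c j, (0 < j)%N -> exists2 C : R, 0 <= C &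
  forall t s, 0 <= t -> t <= s ->
  `|p s c j - p t c j - (s - t) * F c j (p t)| <= (s - t) ^+ 2 * C.

Lemma observable_bounded m (f : state -> R) : lipschitz_window r m f ->
  exists B : R, forall t, `|f (p t)| <= B.
Proof.
move=> [K K0 Kf]; exists (`|f (p 0)| + K * (r + r)) => t.
rewrite -[f (p t)](subrK (f (p 0))) addrC (le_trans (ler_normD _ _))// lerD2l.
apply: Kf => // c i _; rewrite (le_trans (ler_normB _ _))//.
by rewrite lerD// p_bounded.
Qed.

(** Along p the function F is bounded by some B. By the second-order estimate,
    [sg * p s c j - s * B] has increments at most quadratic in time for both signs [sg], hence is
    nonincreasing. Before time 0 the coordinate is constant. *)
Lemma limit_coord_lipschitz c j : exists2 L : R, 0 <= L &
  forall t s, t <= s -> `|p s c j - p t c j| <= (s - t) * L.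
Proof.
case: (posnP j) => [->|j0].
  by exists 0 => // t s _; rewrite !p_0 subrr normr0 mulr0.
have [C C0 HC] := p_second_order c j0; have [B HB] := observable_bounded (F_lip c j).
have B0 : 0 <= B by rewrite (le_trans _ (HB 0)).
have key (sg : R) t s : `|sg| = 1 -> 0 <= t -> t <= s ->
    sg * (p s c j - p t c j) <= (s - t) * B.
  move=> sg1 t0 ts.
  suff : sg * p s c j - s * B <= sg * p t c j - t * B by lra.
  apply: (@nonincreasing_of_quadratic_increments R
    (fun x => sg * p x c j - x * B) (fun x => x * C) _ _ ts) => x y tx xy _.
  have x0 := le_trans t0 tx.
  have -> : sg * p y c j - y * B - (sg * p x c j - x * B) =
    sg * (p y c j - p x c j - (y - x) * F c j (p x)) +
    (y - x) * (sg * F c j (p x) - B) by ring.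
  rewrite -mulrBl mulrA -expr2 -[leRHS]addr0 lerD//.
    by rewrite (le_trans (ler_norm _))// normrM sg1 mul1r HC.
  rewrite mulr_ge0_le0 ?subr_ge0// subr_le0 (le_trans (ler_norm _))//.
  by rewrite normrM sg1 mul1r HB.
have pos t s : 0 <= t -> t <= s -> `|p s c j - p t c j| <= (s - t) * B.
  move=> t0 ts; rewrite ler_norml; apply/andP; split.
    by have := key (-1) t s (normrN1 _) t0 ts; lra.
  by have := key 1 t s (normr1 _) t0 ts; rewrite mul1r.
exists B => // t s ts; case: (leP 0 t) => [t0|/ltW t0]; first exact: pos.
rewrite (p_init t0) -(p_init (lexx 0)).
case: (leP 0 s) => [s0|/ltW s0].
  by rewrite (le_trans (pos _ _ (lexx _) s0))// ler_wpM2r// lerD2l lerN2.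
by rewrite (p_init s0) -(p_init (lexx 0)) subrr normr0 mulr_ge0// subr_ge0.
Qed.

Lemma observable_lipschitz m (f : state -> R) : lipschitz_window r m f ->
  exists2 L : R, 0 <= L & forall t s, t <= s -> `|f (p s) - f (p t)| <= (s - t) * L.
Proof.
move=> [K K0 Kf].
have /choice[L HL] : forall ci : bool * nat, exists L : R, 0 <= L /\
    forall t s, t <= s -> `|p s ci.1 ci.2 - p t ci.1 ci.2| <= (s - t) * L.
  by move=> [c i]; have [L L0 HL] := limit_coord_lipschitz c i; exists L.
pose T := \sum_(ci : bool * 'I_m.+1) L (ci.1, nat_of_ord ci.2).
have T0 : 0 <= T by apply: sumr_ge0 => -[c i] _; have [] := HL (c, nat_of_ord i).
exists (K * T) => [|t s ts]; first exact: mulr_ge0.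
rewrite mulrCA; apply: Kf => // c i im; have [_ Hi] := HL (c, i).
rewrite (le_trans (Hi _ _ ts))// ler_wpM2l ?subr_ge0//.
rewrite /T (bigD1 (c, Ordinal (im : (i < m.+1)%N)))//= lerDl.
by apply: sumr_ge0 => -[c' i'] _; have [] := HL (c', nat_of_ord i').
Qed.

Lemma observable_continuous m (f : state -> R) : lipschitz_window r m f ->
  continuous (fun t => f (p t)).
Proof. by move=> /observable_lipschitz[L _ HL]; exact: lipschitz_continuous HL. Qed.

Lemma limit_derive c j t : (0 < j)%N -> 0 <= t ->
  is_derive_within `[0, +oo[ (fun s => p s c j) t (F c j (p t)).
Proof.
move=> j0 t0; have [C C0 HC] := p_second_order c j0.
have [L L0 HL] := observable_lipschitz (F_lip c j).
apply: (@is_derive_within_quadratic _ _ (fun t => F c j (p t)) (C + L)) => s /=.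
rewrite in_itv /= andbT => s0; case: (leP t s) => [ts|/ltW st].
  by rewrite (le_trans (HC _ _ t0 ts))// ler_wpM2l ?sqr_ge0// lerDl.
(* To the left of t the estimate is based at s; moving F from s to t costs (t - s)^2 L by its
   Lipschitz continuity along p. *)
have -> : p s c j - p t c j - (s - t) * F c j (p t) =
    - (p t c j - p s c j - (t - s) * F c j (p s)) +
    (t - s) * (F c j (p t) - F c j (p s)) by ring.
rewrite (le_trans (ler_normD _ _))// normrN [leRHS]mulrDr -(sqrrN (s - t)) opprB.
rewrite lerD ?HC// normrM ger0_norm ?subr_ge0//.
by rewrite expr2 -mulrA ler_wpM2l ?subr_ge0// HL.
Qed.

Lemma limit_C1 c j : (0 < j)%N -> C1_within `[0, +oo[ (fun s => p s c j).
Proof.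
move=> j0; exists (fun t => F c j (p t)).
  exact/continuous_subspaceT/(observable_continuous (F_lip c j)).
by move=> t /=; rewrite in_itv /= andbT => t0; exact: limit_derive.
Qed.

(** * Dissipation and time integral of the limit energy *)

Section Energy.
Variables (w : bool -> nat -> R) (E : R -> R) (E0 : R).
Local Notation sq := (weighted_sqsum (fun _ _ => 1)).
Local Notation dissip := (weighted_sqsum w).
Hypothesis E_le : forall t, E t <= E0.
Hypothesis sq_le : forall M t, sq M (p t) <= E t.
Hypothesis E_anti : forall t s, t <= s -> E s <= E t.
Hypothesis E_drop : forall M, exists L : R, forall t s, 0 <= t -> t <= s ->
  E s <= E t - (s - t) * (dissip M (p t) - (s - t) * L).
Hypothesis E_tail : forall eps : R, 0 < eps -> exists M (L : R),
  forall t s, 0 <= t -> t <= s ->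
  (s - t) * E s <= (s - t) * (sq M (p t) + (s - t) * L) + eps * (E t - E s).

Lemma energy_bound_ge0 t : 0 <= E t.
Proof. by apply: le_trans (sq_le 0 t); exact: weighted_sqsum_ge0. Qed.

Lemma energy_bound_norm_le t : `|E t| <= E0.
Proof. by rewrite ger0_norm ?energy_bound_ge0. Qed.

Lemma energy_bound_measurable : measurable_fun setT E.
Proof.
rewrite (_ : E = \- (fun t => - E t)); last by apply/funext => t /=; rewrite opprK.
apply: measurableT_comp => //; apply: nondecreasing_measurable => //.
by move=> t s ts; rewrite lerN2 E_anti.
Qed.

Lemma sqsum_measurable v M : measurable_fun setT (fun t => weighted_sqsum v M (p t)).
Proof.
apply: continuous_measurable_fun.
exact: observable_continuous (lipschitz_window_sqsum r v M).
Qed.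

Lemma dissipation_le M t s : 0 <= t -> t <= s ->
  integral_from0 (fun x => dissip M (p x)) s -
  integral_from0 (fun x => dissip M (p x)) t <= E t - E s.
Proof.
move=> t0 ts; set J := integral_from0 _.
have dL := lipschitz_window_sqsum r w M.
have [L HL] := E_drop M; have [L' L'0 HL'] := observable_lipschitz dL.
have [B HB] := observable_bounded dL.
suff : E s + J s <= E t + J t by lra.
apply: (@nonincreasing_of_quadratic_increments R (fun x => E x + J x)
  (fun x => x * (L + L')) _ _ ts) => x y tx xy ys.
have x0 := le_trans t0 tx.
have HJ : J y - J x <= (y - x) * (dissip M (p x) + (y - x) * L').
  apply: (integral_from0_incr_le (sqsum_measurable w M) HB) => // z /andP[xz zy].
  have := HL' _ _ xz; rewrite ler_norml => /andP[_].
  rewrite lerBlDl => /le_trans; apply; rewrite lerD2l ler_wpM2r// lerD2r//.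
by have := HL _ _ x0 xy; move: HJ; lra.
Qed.

Lemma energy_integral_le (eps T : R) : 0 < eps -> 0 <= T -> exists M,
  integral_from0 E T <= integral_from0 (fun x => sq M (p x)) T + eps * E0.
Proof.
move=> e0 T0; have [M [L HL]] := E_tail e0; exists M.
set J := integral_from0 (fun x => sq M (p x)).
have dL := lipschitz_window_sqsum r (fun _ _ => 1) M.
have [L' L'0 HL'] := observable_lipschitz dL; have [B HB] := observable_bounded dL.
have JE0 : integral_from0 E 0 = 0 by exact: integral_from0_0.
have J0 : J 0 = 0 by exact: integral_from0_0.
suff : integral_from0 E T - J T + eps * E T <= integral_from0 E 0 - J 0 + eps * E 0.
  rewrite JE0 J0; have := ler_wpM2l (ltW e0) (E_le 0).
  have := mulr_ge0 (ltW e0) (energy_bound_ge0 T); lra.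
(* The integral of E over [x, y] is bounded through the left value E x, whereas [E_tail] controls E
   y. The discrepancy (y - x) (E x - E y) is absorbed by the summand - E of W. *)
apply: (@nonincreasing_of_quadratic_increments R
  (fun x => integral_from0 E x - J x + eps * E x)
  (fun x => x * (L + L') - E x) _ _ T0) => x y x0 xy _.
have HE : integral_from0 E y - integral_from0 E x <= (y - x) * E x.
  apply: (integral_from0_incr_le energy_bound_measurable energy_bound_norm_le) => // z /andP[xz _].
  exact: E_anti.
have HJ : (y - x) * (sq M (p x) - (y - x) * L') <= J y - J x.
  apply: (integral_from0_incr_ge (sqsum_measurable _ M) HB) => // z /andP[xz zy].
  have := HL' _ _ xz; rewrite ler_norml => /andP[+ _].
  rewrite lerNl opprB => h; rewrite lerBlDl -lerBlDr (le_trans h)//.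
  by rewrite ler_wpM2r// lerD2r.
by have := HL _ _ x0 xy; move: HE HJ; lra.
Qed.

End Energy.
End LimitRegularity.

(** * The energy inequality *)

Section Norms.
Variable R : realType.
Implicit Types (f : nat -> R) (u : nat -> R).

Lemma eseries1_le f (B : R) : (forall n, 0 <= f n) ->
  (forall M, \sum_(1 <= n < M.+1) f n <= B) ->
  (\sum_(1 <= n <oo) (f n)%:E <= B%:E)%E.
Proof.
move=> f0 fB; apply: lime_le.
  by apply: is_cvg_nneseries => n _ _; rewrite lee_fin.
near=> M; rewrite sumEFin lee_fin.
have M0 : (0 < M)%N by near: M; exact: nbhs_infty_ge.
by rewrite -(prednK M0) fB.
Unshelve. all: by end_near. Qed.

Lemma le_eseries1 f M : (forall n, 0 <= f n) ->
  ((\sum_(1 <= n < M.+1) f n)%:E <= \sum_(1 <= n <oo) (f n)%:E)%E.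
Proof.
move=> f0; rewrite -sumEFin; apply: nneseries_lim_ge => n _ _.
by rewrite lee_fin.
Qed.

Lemma normH_sqr u : (normH u ^+ 2 = \sum_(1 <= n <oo) (u n ^+ 2)%:E)%E.
Proof.
by rewrite sqr_sqrte//; apply: nneseries_ge0 => n _ _; rewrite lee_fin sqr_ge0.
Qed.

Lemma norm1_sqr lam u : (norm1 lam u ^+ 2 =
  \sum_(1 <= n <oo) (wavenumber lam n ^+ 2 * u n ^+ 2)%:E)%E.
Proof.
rewrite sqr_sqrte//; apply: nneseries_ge0 => n _ _.
by rewrite lee_fin mulr_ge0 ?sqr_ge0.
Qed.

Lemma normH_lty u : (normH u < +oo)%E = (normH u ^+ 2 < +oo)%E.
Proof.
rewrite normH_sqr /normH; set X := (\sum_(1 <= n <oo) _)%E.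
have X0 : (0 <= X)%E by apply: nneseries_ge0 => n _ _; rewrite lee_fin sqr_ge0.
by rewrite -!ge0_fin_numE ?sqrte_ge0// sqrte_fin_num.
Qed.

Lemma normH_sqrD (u : bool -> nat -> R) :
  (normH (u true) ^+ 2 + normH (u false) ^+ 2 =
   \sum_(1 <= n <oo) (\sum_(c : bool) 1 * u c n ^+ 2)%:E)%E.
Proof.
rewrite !normH_sqr -nneseriesD; [|by move=> n _ _; rewrite lee_fin sqr_ge0..].
by apply: eq_eseriesr => n _; rewrite big_bool /= !mul1r EFinD.
Qed.

Lemma normH_sqrD_le (u : bool -> nat -> R) (B : R) :
  (forall M, weighted_sqsum (fun _ _ => 1) M u <= B) ->
  (normH (u true) ^+ 2 + normH (u false) ^+ 2 <= B%:E)%E.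
Proof.
move=> uB; rewrite normH_sqrD; apply: eseries1_le => // n.
by apply: sumr_ge0 => c _; rewrite mul1r sqr_ge0.
Qed.

Lemma le_normH_sqrD (u : bool -> nat -> R) M :
  ((weighted_sqsum (fun _ _ => 1) M u)%:E <=
   normH (u true) ^+ 2 + normH (u false) ^+ 2)%E.
Proof.
rewrite normH_sqrD; apply: le_eseries1 => n.
by apply: sumr_ge0 => c _; rewrite mul1r sqr_ge0.
Qed.

End Norms.

Lemma ge0_integral_lin2 d (T : measurableType d) (R : realType)
    (m : {measure set T -> \bar R}) (D : set T) (f g : T -> \bar R) (k l : R) :
  measurable D -> 0 <= k -> 0 <= l -> (forall x, 0 <= f x)%E ->
  (forall x, 0 <= g x)%E -> measurable_fun D f -> measurable_fun D g ->
  (k%:E * \int[m]_(x in D) f x + l%:E * \int[m]_(x in D) g x =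
   \int[m]_(x in D) (k%:E * f x + l%:E * g x))%E.
Proof.
move=> mD k0 l0 f0 g0 mf mg; rewrite ge0_integralD//.
- by rewrite !ge0_integralZl.
- by move=> x _; rewrite mule_ge0.
- exact: measurable_funeM.
- by move=> x _; rewrite mule_ge0.
- exact: measurable_funeM.
Qed.

(** * Equality of E and |p|^2 almost everywhere, and the integrated dissipation *)

Section EnergyInequality.
Variables (R : realType) (lam nu mu : R) (p : R -> bool -> nat -> R).
Variables (E : R -> R) (E0 : R).
Hypotheses (nu_gt0 : 0 < nu) (mu_gt0 : 0 < mu).
Local Notation w := (hall_weight lam nu mu).
Local Notation sq := (weighted_sqsum (fun _ _ => 1)).
Local Notation leb := (@lebesgue_measure R).

Hypothesis sqsum_meas : forall v M,
  measurable_fun setT (fun t => weighted_sqsum v M (p t)).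
Hypothesis E_meas : measurable_fun setT E.
Hypothesis E_bounds : forall t, 0 <= E t <= E0.
Hypothesis sq_le : forall M t, sq M (p t) <= E t.
Hypothesis p_0 : forall t c, p t c 0%N = 0.
Hypothesis E_integral_le : forall eps T : R, 0 < eps -> 0 <= T -> exists M,
  integral_from0 E T <= integral_from0 (fun x => sq M (p x)) T + eps * E0.
Hypothesis diss_le : forall M t s, 0 <= t -> t <= s ->
  integral_from0 (fun x => weighted_sqsum w M (p x)) s -
  integral_from0 (fun x => weighted_sqsum w M (p x)) t <= E t - E s.
Hypothesis diss_bounded : forall M, exists B : R, forall t,
  `|weighted_sqsum w M (p t)| <= B.

Local Notation S t := (normH (p t true) ^+ 2 + normH (p t false) ^+ 2)%E.

Lemma energy_sup_ge t : (S t <= (E t)%:E)%E.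
Proof. exact: normH_sqrD_le. Qed.

(** One shell is the difference of two consecutive partial sums; shell 0 lies outside these sums and
    vanishes by [p_0]. *)
Lemma sqsum_term_meas (v : bool -> nat -> R) n :
  measurable_fun setT (fun t => \sum_(c : bool) v c n * p t c n ^+ 2).
Proof.
case: n => [|n].
  rewrite (_ : (fun t => _) = cst 0); first exact: measurable_cst.
  by apply/funext => t; apply: big1 => c _; rewrite p_0 expr0n mulr0.
rewrite (_ : (fun t => _) = (fun t => weighted_sqsum v n.+1 (p t)) \-
  (fun t => weighted_sqsum v n (p t))); first exact: measurable_funB.
by apply/funext => t /=; rewrite /weighted_sqsum [in RHS]big_nat_recr//= addrAC subrr add0r.
Qed.

Lemma energy_sup_meas : measurable_fun setT (fun t => S t).
Proof.
under eq_fun => t do rewrite normH_sqrD eseries_cond.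
apply: ge0_emeasurable_sum => // [n t _ _|n _].
  by rewrite lee_fin; apply: sumr_ge0 => c _; rewrite mul1r sqr_ge0.
by apply/measurable_EFinP; exact: (sqsum_term_meas (fun _ _ => 1)).
Qed.

(** The gap g between E and |p|^2 is nonnegative and at most [E - sq M], whose integral can be made
    arbitrarily small by the choice of M. So g has integral 0 and vanishes almost everywhere. *)
Lemma energy_attained_itv (T : R) : 0 <= T ->
  {ae leb, forall t, 0 <= t <= T -> ((E t)%:E = S t)%E}.
Proof.
move=> T0; pose g t := ((E t)%:E - S t)%E.
have mg : measurable_fun `[0, T] g.
  apply: measurable_funTS; apply: emeasurable_funB; first exact/measurable_EFinP.
  exact: energy_sup_meas.
have S_fin t : S t \is a fin_num.
  rewrite ge0_fin_numE ?(le_lt_trans (energy_sup_ge t)) ?ltry//.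
  by rewrite adde_ge0// normH_sqr nneseries_ge0// => n _ _; rewrite lee_fin sqr_ge0.
have g0 t : (0 <= g t)%E by rewrite sube_ge0 ?S_fin ?orbT//; exact: energy_sup_ge.
suff : (\int[leb]_(t in `[0%R, T]) `|g t| = 0)%E.
  move=> /ae_eq_integral_abs => /(_ (measurable_itv _) mg).
  apply: filterS => t H tT; have := H; rewrite /= in_itv => /(_ tT) /eqP.
  by rewrite sube_eq ?fin_num_adde_defl// add0e => /eqP.
apply/eqP; rewrite eq_le integral_ge0 ?andbT//.
apply/lee_addgt0Pr => e e0; rewrite add0e.
have E0_ge0 : 0 <= E0 by have /andP[/le_trans] := E_bounds 0; apply.
have E01 : 0 < E0 + 1 by rewrite ltr_wpDl.
(* With eps = e / (E0 + 1) the error eps E0 is at most e, also when E0 = 0. *)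
have [M HM] := E_integral_le (divr_gt0 e0 E01) T0.
have Eb t : `|E t| <= E0 by have /andP[h1 h2] := E_bounds t; rewrite ger0_norm.
have sqb t : `|sq M (p t)| <= E0.
  rewrite ger0_norm ?weighted_sqsum_ge0//.
  by have /andP[_] := E_bounds t; exact: le_trans.
have iE : leb.-integrable `[0, T] (EFin \o E) 
  by apply: (bounded_integrable_itv (a := 0) (b := T) E_meas Eb).
have iP : leb.-integrable `[0, T] (EFin \o (fun t => sq M (p t))).
  by apply: (bounded_integrable_itv (a := 0) (b := T) (sqsum_meas _ M) sqb).
apply: (@le_trans _ _ (\int[leb]_(t in `[0%R, T]) (E t - sq M (p t))%:E)%E).
  apply: ge0_le_integral => //.
  - exact: measurableT_comp.
  - apply/measurable_EFinP; apply: measurable_funTS; apply: measurable_funB => //.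
    exact: sqsum_meas.
  - move=> t _; rewrite gee0_abs// EFinB leeB//.
    exact: le_normH_sqrD.
under eq_integral do rewrite EFinB.
rewrite integralB// -[X in (X - _)%E]fineK ?integrable_fin_num//.
rewrite -[X in (_ - X)%E]fineK ?integrable_fin_num// -EFinB lee_fin.
move: HM; rewrite /integral_from0 /Rintegral -lerBlDl => /le_trans; apply.
by rewrite mulrAC -mulrA ger_pMr// ler_pdivrMr// mul1r lerDl.
Qed.

Lemma energy_attained :
  {ae leb, forall t, 0 <= t -> ((E t)%:E = S t)%E}.
Proof.
have /ae_foralln : forall n : nat, {ae leb, forall t, 0 <= t <= n%:R -> ((E t)%:E = S t)%E}.
  by move=> n; exact: energy_attained_itv.
apply: filterS => t H t0; apply: (H (Num.truncn t).+1).
by rewrite t0 ltW// Num.Theory.truncnS_gt.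
Qed.

(** All terms are nonnegative, so series and integral commute, and [diss_le] bounds the integral of
    each partial sum by the same energy drop. *)
Lemma dissipation_integral_le t1 t : 0 <= t1 -> t1 <= t ->
  ((2 * nu)%:E * \int[leb]_(tau in `[t1, t]) (norm1 lam (p tau true) ^+ 2) +
   (2 * mu)%:E * \int[leb]_(tau in `[t1, t]) (norm1 lam (p tau false) ^+ 2)
   <= (E t1 - E t)%:E)%E.
Proof.
move=> t10 t1t.
have nu2 : 0 <= 2 * nu by rewrite mulr_ge0// ltW.
have mu2 : 0 <= 2 * mu by rewrite mulr_ge0// ltW.
have w_ge0 c j : 0 <= w c j by rewrite /hall_weight; case: c; rewrite mulr_ge0 ?sqr_ge0.
have d0 n x : 0 <= \sum_(c : bool) w c n * p x c n ^+ 2.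
  by apply: sumr_ge0 => c _; rewrite mulr_ge0// sqr_ge0.
have n1_ge0 c x : (0 <= norm1 lam (p x c) ^+ 2)%E.
  rewrite norm1_sqr nneseries_ge0// => n _ _.
  by rewrite lee_fin mulr_ge0 ?sqr_ge0.
have n1_meas c : measurable_fun `[t1, t] (fun x => (norm1 lam (p x c) ^+ 2)%E).
  apply: measurable_funTS; under eq_fun => x do rewrite norm1_sqr eseries_cond.
  apply: ge0_emeasurable_sum => // [n x _ _|n _].
    by rewrite lee_fin mulr_ge0 ?sqr_ge0.
  apply/measurable_EFinP.
  (* This weight selects the field c, so that measurability follows from that of the two-field
     sums. *)
  pose v (c' : bool) n : R := if c' == c then wavenumber lam n ^+ 2 else 0.
  rewrite (_ : (fun x => _) = fun x => \sum_(c' : bool) v c' n * p x c' n ^+ 2).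
    exact: sqsum_term_meas.
  apply/funext => x; rewrite (bigD1 c)//= /v eqxx big1 ?addr0// => c' /negPf ->.
  by rewrite mul0r.
rewrite ge0_integral_lin2//; [|exact: (n1_meas true)|exact: (n1_meas false)].
have -> : (fun x => (2 * nu)%:E * norm1 lam (p x true) ^+ 2 +
    (2 * mu)%:E * norm1 lam (p x false) ^+ 2)%E =
    (fun x => \sum_(0 <= n <oo) (\sum_(c : bool) w c n * p x c n ^+ 2)%:E)%E.
  (* The series is restarted at 0, where its term vanishes by [p_0], to fit the exchange of series
     and integral. *)
  apply/funext => x; rewrite nneseries_recl//; last by move=> n _; rewrite lee_fin.
  rewrite big1 ?add0e => [|c _]; last by rewrite p_0 expr0n mulr0.
  rewrite !norm1_sqr -!nneseriesZl; [|by move=> n _; rewrite lee_fin mulr_ge0 ?sqr_ge0..].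
  rewrite -nneseriesD; last 2 first.
    by move=> n _ _; apply: mule_ge0; rewrite lee_fin// mulr_ge0 ?sqr_ge0.
    by move=> n _ _; apply: mule_ge0; rewrite lee_fin// mulr_ge0 ?sqr_ge0.
  apply: eq_eseriesr => n _; rewrite big_bool /= /hall_weight.
  by rewrite -!EFinM -EFinD !mulrA.
have dm n : measurable_fun `[t1, t]
    (fun x => (\sum_(c : bool) w c n * p x c n ^+ 2)%:E).
  by apply/measurable_EFinP; apply: measurable_funTS; exact: sqsum_term_meas.
rewrite integral_nneseries//; last by move=> n x _; rewrite lee_fin.
apply: lime_le.
  apply: is_cvg_nneseries => n _ _; apply: integral_ge0 => x _.
  by rewrite lee_fin.
near=> M; rewrite -ge0_integral_sum//; last by move=> n x _; rewrite lee_fin.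
have M0 : (0 < M)%N by near: M; exact: nbhs_infty_ge.
have -> : (fun x => \sum_(0 <= n < M) (\sum_(c : bool) w c n * p x c n ^+ 2)%:E)%E =
    EFin \o (fun x => weighted_sqsum w M.-1 (p x)).
  apply/funext => x; rewrite sumEFin /= /weighted_sqsum prednK//.
  rewrite [in LHS]big_ltn// big1 ?add0r// => c _.
  by rewrite p_0 expr0n mulr0.
have [B HB] := diss_bounded M.-1.
have mD := sqsum_meas w M.-1.
rewrite -[leLHS]fineK; last first.
  by apply: integrable_fin_num => //; apply: (bounded_integrable_itv (a := t1) (b := t) mD HB).
rewrite lee_fin (le_trans _ (diss_le M.-1 t10 t1t))//.
rewrite (integral_from0_incr mD HB)// Rintegral_itv_obnd_cbnd//.
by apply: (bounded_integrable_itv (a := t1) (b := t) mD HB); exact: subset_itv_oc_cc.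
Unshelve. all: by end_near. Qed.

(** At every t the energy of p is at most E t, and adding the dissipation gives at most E t1.
    Equality of E and |p|^2 is used at t1 only, hence almost every t1 but all t. *)
Lemma limit_energy_inequality : {ae leb, forall t1, 0 <= t1 ->
  forall t, t1 <= t -> energy_inequality lam nu mu
    (fun s => p s true) (fun s => p s false) t1 t}.
Proof.
have := energy_attained; apply: filterS; first exact: (ae_filter_ringOfSetsType leb).
move=> t1 Et1 t10 t t1t; rewrite /energy_inequality.
rewrite -Et1// -addeA; have := dissipation_integral_le t10 t1t.
move=> /(leeD (energy_sup_ge t)) /le_trans; apply.
by rewrite -EFinD lee_fin addrC subrK.
Qed.

End EnergyInequality.

(** * Existence *)

Section HallWeight.
Variables (R : realType) (lam nu mu : R).
Hypotheses (lam_gt1 : 1 < lam) (nu_gt0 : 0 < nu) (mu_gt0 : 0 < mu).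

Lemma hall_weight_ge c j :
  2 * Num.min nu mu * lam ^+ j <= hall_weight lam nu mu c j.
Proof.
have lj : 1 <= lam ^+ j by rewrite exprn_ege1// ltW.
rewrite /hall_weight /wavenumber; apply: ler_pM => //.
- by rewrite mulr_ge0// le_min !ltW.
- exact: le_trans lj.
- by rewrite ler_wpM2l//; case: c; rewrite ge_min lexx ?orbT.
- by rewrite expr2 ler_peMl// (le_trans _ lj).
Qed.

Lemma hall_weight_unbounded (eps : R) : 0 < eps ->
  exists M, forall c j, (M < j)%N -> 1 <= eps * hall_weight lam nu mu c j.
Proof.
move=> e0; pose k := 2 * Num.min nu mu.
have k0 : 0 < k by rewrite mulr_gt0// lt_min nu_gt0.
(* Linear growth of the powers is enough, and it makes M explicit. *)
have bernoulli n : n%:R * (lam - 1) <= lam ^+ n.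
  elim: n => [|n IH]; first by rewrite mul0r expr0.
  have ln : 1 <= lam ^+ n by rewrite exprn_ege1// ltW.
  have l1 : 0 <= lam - 1 by rewrite subr_ge0 ltW.
  by rewrite exprS -natr1; have := ler_wpM2r l1 ln; move: IH; lra.
have q0 : 0 < eps * k * (lam - 1) by rewrite mulr_gt0 ?subr_gt0// mulr_gt0.
exists (Num.truncn (eps * k * (lam - 1))^-1) => c j Mj.
rewrite (le_trans _ (ler_wpM2l (ltW e0) (hall_weight_ge c j)))// -/k.
rewrite (le_trans _ (ler_wpM2l (ltW e0) (ler_wpM2l (ltW k0) (bernoulli j))))//.
have : (eps * k * (lam - 1))^-1 <= j%:R.
  by rewrite (le_trans (ltW (Num.Theory.truncnS_gt _)))// ler_nat.
by move=> /(ler_wpM2r (ltW q0)); rewrite mulVf ?gt_eqF//; lra.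
Qed.

End HallWeight.

(** The abstract limit is applied with [E0] the initial energy [fine X] and [kappa] equal to 2
    min(nu, mu), a lower bound of the weights since all powers of lam are at least 1. *)
Lemma leray_hopf_exists (R : realType) (lam nu mu di theta : R) (a0 b0 : nat -> R) :
  1 < lam -> 0 < nu -> 0 < mu -> ell2 a0 -> ell2 b0 ->
  exists a b : R -> nat -> R,
    leray_hopf_solution lam nu mu di theta 0 a b /\ (a 0 = a0 /\ b 0 = b0).
Proof.
move=> lam_gt1 nu_gt0 mu_gt0 [a00 a0H] [b00 b0H].
pose u0 (c : bool) := if c then a0 else b0.
pose X := (normH (u0 true) ^+ 2 + normH (u0 false) ^+ 2)%E.
have n0 (u : nat -> R) : (0 <= normH u ^+ 2)%E.
  by rewrite normH_sqr nneseries_ge0// => n _ _; rewrite lee_fin sqr_ge0.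
have X_fin : X \is a fin_num.
  by rewrite ge0_fin_numE ?adde_ge0// lte_add_pinfty// -normH_lty.
have E0_ge0 : 0 <= fine X by rewrite fine_ge0// adde_ge0.
have kappa_gt0 : 0 < 2 * Num.min nu mu by rewrite mulr_gt0// lt_min nu_gt0.
have w_ge c j : 2 * Num.min nu mu <= hall_weight lam nu mu c j.
  rewrite (le_trans _ (hall_weight_ge lam_gt1 nu_gt0 mu_gt0 c j))//.
  by rewrite ler_peMr ?(ltW kappa_gt0)// exprn_ege1// ltW.
have u0_0 c : u0 c 0%N = 0 by case: c.
have u0_E0 N : weighted_sqsum (fun _ _ => 1) N u0 <= fine X.
  by rewrite -lee_fin fineK// le_normH_sqrD.
pose F := hall_rhs lam nu mu di theta.
have F_balance N (u : bool -> nat -> R) : (forall c, u c 0%N = 0) ->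
    (forall c, u c N.+1 = 0) ->
    2 * (\sum_(1 <= j < N.+1) \sum_(c : bool) u c j * F c j u) =
    - weighted_sqsum (hall_weight lam nu mu) N u.
  by move=> u00 uN; exact: hall_energy_balance.
have F_lip c j : lipschitz_window (1 + fine X) j.+1 (F c j).
  exact: hall_rhs_lipschitz.
have F_0 c j : F c j (fun _ _ => 0) = 0 by exact: hall_rhs0.
have [p [E [[p_bounded p_0] p_init [sq_le E_le E_anti] p_second [E_drop E_tail]]]] :=
  galerkin_limit E0_ge0 kappa_gt0 w_ge
    (hall_weight_unbounded lam_gt1 nu_gt0 mu_gt0) u0_0 u0_E0 F_0 F_balance F_lip.
exists (fun t => p t true), (fun t => p t false); split; last first.
  by rewrite p_init//.
have p_ell2 t c : ell2 (p t c).
  split; first exact: p_0.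
  rewrite normH_lty (@le_lt_trans _ _ (E t)%:E) ?ltry//.
  apply: le_trans (normH_sqrD_le (sq_le ^~ t)).
  by case: c; rewrite ?leeDl ?leeDr.
split.
  split=> [t t0|j j1|j t j1 t0]; split=> //.
  - exact: (limit_C1 F_lip p_bounded p_0 p_init p_second true j1).
  - exact: (limit_C1 F_lip p_bounded p_0 p_init p_second false j1).
  - exact: (limit_derive F_lip p_bounded p_0 p_init p_second j1 t0).
  - exact: (limit_derive F_lip p_bounded p_0 p_init p_second j1 t0).
apply: (limit_energy_inequality (E := E) (E0 := fine X)) => //.
- exact: (sqsum_measurable F_lip p_bounded p_0 p_init p_second).
- exact: energy_bound_measurable E_anti.
- by move=> t; rewrite (energy_bound_ge0 sq_le) E_le.
- exact: (energy_integral_le F_lip p_bounded p_0 p_init p_second E_le sq_le E_anti E_tail).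
- exact: (dissipation_le F_lip p_bounded p_0 p_init p_second E_drop).
- by move=> M; exact: (observable_bounded p_bounded (lipschitz_window_sqsum _ _ _)).
Qed.

Theorem theorem5p2 (R : realType) (lam nu mu di delta theta : R)
    (hlam : 1 < lam) (hnu : 0 < nu) (hmu : 0 < mu) (hdi : 0 <= di)
    (htheta : theta = (5 - delta) / 2)
    (a0 b0 : nat -> R) (ha0 : ell2 a0) (hb0 : ell2 b0) :
  exists a b : R -> nat -> R,
    leray_hopf_solution lam nu mu di theta 0 a b /\ (a 0 = a0 /\ b 0 = b0).
Proof. exact: leray_hopf_exists. Qed.
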